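(* Let $I=[0,\gamma)$ with $0<\gamma\le\infty$ and let $w$ be a weight function on $I$. Let $\varphi$ and $(\varphi_n)_{n=1}^\infty$ be Orlicz functions that all satisfy the $\Delta_2$-condition if $\gamma=\infty$, and the $\Delta_2^\infty$-condition if $\gamma<\infty$. Suppose that (i) for every $n\in\mathbb{N}$, $\varphi\prec\varphi_n$ if $\gamma=\infty$ (respectively, $\varphi\prec_\infty\varphi_n$ if $\gamma<\infty$), and (ii) $\Lambda_{\varphi_n,w}\subsetneq\Lambda_{\varphi_{n+1},w}$ for every $n\in\mathbb{N}$. Then $\Lambda_{\varphi,w}\setminus\bigcup_{n=1}^\infty\Lambda_{\varphi_n,w}$ is maximal-spaceable (specifically, $\mathfrak{c}$-spaceable) in $\Lambda_{\varphi,w}$.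
   Context: The interval $I=[0,\gamma)$ carries Lebesgue measure $m$. $L_0$ is the space of real Lebesgue measurable functions on $I$ modulo a.e. equality. For $f\in L_0$, $d_f(\lambda)=m(\{t\in I:|f(t)|>\lambda\})$ for $\lambda>0$, and $f^*(t)=\inf\{\lambda>0:d_f(\lambda)\le t\}$ for $t\ge 0$ (with $\inf\varnothing=\infty$). An Orlicz function is a convex function $\varphi:[0,\infty)\to[0,\infty)$ with $\varphi(0)=0=\lim_{u\to0}\varphi(u)$ and $\varphi(u)>0$ for $u>0$ (put $\varphi(\infty)=\infty$). It satisfies the $\Delta_2^\infty$-condition if there are $K>2$, $u_0\ge0$ with $\varphi(2u)\le K\varphi(u)$ for all $u\ge u_0$; the $\Delta_2^0$-condition if there are $K>2$, $u_0>0$ with $\varphi(2u)\le K\varphi(u)$ for all $0\le u\le u_0$; the $\Delta_2$-condition if it satisfies both. Write $\varphi\prec\psi$ if there is $b>0$ with $\varphi(u)\le\psi(bu)$ for all $u\ge0$, and $\varphi\prec_\infty\psi$ if there are $b>0$, $u_0\ge0$ with $\varphi(u)\le\psi(bu)$ for all $u\ge u_0$. A weight function on $I$ is a positive, decreasing (i.e. nonincreasing) function $w:I\setminus\{0\}\to(0,\infty)$ with $\int_0^t w<\infty$ for every $t\in I$; if $\gamma=\infty$ it is also assumed that $\int_0^\infty w=\infty$. The modular is $\rho_{\varphi,w}(f)=\int_I\varphi(f^*(t))w(t)\,dt$. The Orlicz-Lorentz space is $\Lambda_{\varphi,w}=\{f\in L_0:\rho_{\varphi,w}(kf)<\infty\text{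 for some }k>0\}$ with the Luxemburg norm $\|f\|_{\varphi,w}=\inf\{\varepsilon>0:\rho_{\varphi,w}(f/\varepsilon)\le1\}$ (a Banach space). $\mathfrak{c}$ is the cardinality of the continuum; $\dim$ is algebraic dimension. A subset $A$ of a topological vector space $X$ is $\alpha$-spaceable in $X$ ($\alpha$ a cardinal) if there is a closed $\alpha$-dimensional vector subspace $M$ of $X$ with $M\subset A\cup\{0\}$; it is maximal-spaceable if it is $\dim(X)$-spaceable. *)

(* Defs.v *)
From HB Require Import structures.
From mathcomp Require Import all_boot all_order all_algebra.
From mathcomp Require Import all_classical all_reals all_analysis.
From mathcomp Require Import measurable_realfun.

Set Implicit Arguments.
Unset Strict Implicit.
Unset Printing Implicit Defensive.
Import Order.TTheory GRing.Theory Num.Theory.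
Import numFieldNormedType.Exports.

Local Open Scope classical_set_scope.
Local Open Scope ring_scope.

(* Vector space structure on {mfun_ mu, T >-> R}, the measurable functions
   modulo mu-a.e. equality. *)
Section ae_eq_lmodule.
Local Open Scope quotient_scope.
Context d (T : measurableType d) (R : realType).
Variable mu : {measure set T -> \bar R}.
Local Notation L0 := {mfun_ mu, T >-> R}.
Implicit Types f g : {mfun T >-> R}.

Definition aefun_zero : L0 := lift_cst L0 (0 : {mfun T >-> R}).
Definition aefun_opp := lift_op1 L0 (fun f => - f).
Definition aefun_add := lift_op2 L0 (fun f g => f + g).
Definition aefun_scale (a : R) := lift_op1 L0 (fun f => a *: f).

Canonical aefun_pi_zero := PiConst aefun_zero.

Lemma aefun_piP f g : f = g %[ae mu] -> \pi_L0 f = \pi_L0 g.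
Proof. by move=> fg; apply/eqmodP/asboolP. Qed.

Lemma aefun_reprP f : repr (\pi_L0 f) = f %[ae mu].
Proof.
have /eqmodP/asboolP : \pi_L0 (repr (\pi_L0 f)) = \pi_L0 f by rewrite reprK.
exact.
Qed.

Lemma aefun_pi_opp : {morph \pi_L0 : f / - f >-> aefun_opp f}.
Proof.
move=> f; unlock aefun_opp; apply/aefun_piP/ae_eq_sym.
by have := aefun_reprP f; apply: filterS => x fx xT /=; congr (- _); exact: fx.
Qed.
Canonical aefun_pi_opp_morph := PiMorph1 aefun_pi_opp.

Lemma aefun_pi_add : {morph \pi_L0 : f g / f + g >-> aefun_add f g}.
Proof.
move=> f g; unlock aefun_add; apply/aefun_piP/ae_eq_sym.
have := aefun_reprP g; have := aefun_reprP f; apply: filterS2.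
by move=> x fx gx xT /=; congr (_ + _); [exact: fx | exact: gx].
Qed.
Canonical aefun_pi_add_morph := PiMorph2 aefun_pi_add.

Lemma aefun_pi_scale a : {morph \pi_L0 : f / a *: f >-> aefun_scale a f}.
Proof.
move=> f; unlock aefun_scale; apply/aefun_piP/ae_eq_sym.
by have := aefun_reprP f; apply: filterS => x fx xT /=; congr (_ * _); exact: fx.
Qed.
Canonical aefun_pi_scale_morph a := PiMorph1 (aefun_pi_scale a).

Let addA : associative aefun_add.
Proof. by move=> x y z; rewrite -[x]reprK -[y]reprK -[z]reprK !piE addrA. Qed.

Let addC : commutative aefun_add.
Proof. by move=> x y; rewrite -[x]reprK -[y]reprK !piE addrC. Qed.

Let add0 : left_id aefun_zero aefun_add.
Proof. by move=> x; rewrite -[x]reprK !piE add0r. Qed.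

Let addN : left_inverse aefun_zero aefun_opp aefun_add.
Proof. by move=> x; rewrite -[x]reprK !piE addNr. Qed.

HB.instance Definition _ := GRing.isZmodule.Build L0 addA addC add0 addN.

Let scaleA a b (x : L0) :
  aefun_scale a (aefun_scale b x) = aefun_scale (a * b) x.
Proof. by rewrite -[x]reprK !piE scalerA. Qed.

Let scale1 : left_id 1 aefun_scale.
Proof. by move=> x; rewrite -[x]reprK !piE scale1r. Qed.

Let scaleDr : right_distributive aefun_scale +%R.
Proof.
move=> a x y; rewrite -[x]reprK -[y]reprK.
by rewrite -[_ + _]/(aefun_add _ _) -[RHS]/(aefun_add _ _) !piE scalerDr.
Qed.

Let scaleDl (x : L0) : {morph aefun_scale^~ x : a b / a + b}.
Proof.
move=> a b; rewrite -[x]reprK.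
by rewrite -[RHS]/(aefun_add _ _) !piE scalerDl.
Qed.

HB.instance Definition _ :=
  GRing.Zmodule_isLmodule.Build R L0 scaleA scale1 scaleDr scaleDl.

End ae_eq_lmodule.

Section lebesgue_L0.
Context {R : realType}.
Local Open Scope ereal_scope.

(* The line with the sigma-algebra of Lebesgue (not only Borel) sets. *)
Definition lebesgueR : measurableType _ :=
  caratheodory_type (@wlength R idfun)^*%mu.

(* I = [0, gamma[, with gamma possibly +oo *)
Definition itvI (gamma : \bar R) : set R :=
  [set t | (0 <= t)%R /\ t%:E < gamma].

Lemma measurable_itvI gamma : measurable (itvI gamma : set lebesgueR).
Proof.
apply: sub_caratheodory.
apply: is_interval_measurable => x y [x0 _] [_ yg] z /andP[xz zy].
by split; [exact: le_trans xz | apply: le_lt_trans yg; rewrite lee_fin].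
Qed.

Definition lebesgueI (gamma : \bar R) : set lebesgueR -> \bar R :=
  mrestr (@completed_lebesgue_measure R) (measurable_itvI gamma).

HB.instance Definition _ gamma := Measure.on (lebesgueI gamma).

(* Functions on I are represented by functions on the whole line: as these are
   identified when they agree a.e. for the restriction of Lebesgue measure to
   I, only their values on I matter. *)
Definition L0 (gamma : \bar R) : Type :=
  {mfun_ (lebesgueI gamma), lebesgueR >-> R}.
HB.instance Definition _ gamma := GRing.Lmodule.on (L0 gamma).

Definition L0_fun gamma (f : L0 gamma) : R -> R := aqEqMfun_to_fun f.
Coercion L0_fun : L0 >-> Funclass.

End lebesgue_L0.

Section orlicz_lorentz.
Context {R : realType}.
Implicit Types (gamma : \bar R) (phi psi w : R -> R).

(* Only the values on [0, +oo[ are relevant; nonnegativity there follows from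
   the second and fourth items. *)
Definition orlicz_function phi : Prop :=
  [/\ convex_function (`[0, +oo[ : set R) phi,
      phi 0 = 0,
      phi u @[u --> 0^'+] --> (0 : R) &
      forall u, 0 < u -> 0 < phi u].

Definition Delta2_infty phi : Prop :=
  exists K u0 : R, [/\ 2 < K, 0 <= u0 &
    forall u, u0 <= u -> phi (2 * u) <= K * phi u].

Definition Delta2_zero phi : Prop :=
  exists K u0 : R, [/\ 2 < K, 0 < u0 &
    forall u, 0 <= u <= u0 -> phi (2 * u) <= K * phi u].

Definition Delta2 phi : Prop := Delta2_zero phi /\ Delta2_infty phi.

Definition orlicz_prec phi psi : Prop :=
  exists2 b : R, 0 < b & forall u, 0 <= u -> phi u <= psi (b * u).

Definition orlicz_prec_infty phi psi : Prop :=
  exists b u0 : R, [/\ 0 < b, 0 <= u0 &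
    forall u, u0 <= u -> phi u <= psi (b * u)].

Local Open Scope ereal_scope.

(* The value of w at 0 is irrelevant. *)
Definition weight_function gamma w : Prop :=
  [/\ forall t : R, (0 < t)%R -> t%:E < gamma -> (0 < w t)%R,
      forall s t : R, (0 < s)%R -> (s <= t)%R -> t%:E < gamma -> (w t <= w s)%R,
      forall t : R, itvI gamma t ->
        \int[lebesgue_measure]_(s in `]0%R, t]) (w s)%:E < +oo &
      gamma = +oo ->
        \int[lebesgue_measure]_(s in `]0%R, +oo[) (w s)%:E = +oo].

Definition distr_fun gamma (f : L0 gamma) (l : R) : \bar R :=
  lebesgueI gamma [set t | (l < `|f t|)%R].

(* ereal_inf set0 = +oo *)
Definition rearr gamma (f : L0 gamma) (t : R) : \bar R :=
  ereal_inf [set l%:E | l in [set l : R | (0 < l)%R /\ distr_fun f l <= t%:E]].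

(* phi extended by phi(+oo) = +oo; rearr never takes the value -oo *)
Definition orlicz_ext phi (x : \bar R) : \bar R :=
  if x is r%:E then (phi r)%:E else +oo.

(* The integrand is monotone on I minus 0, hence Borel measurable there, so
   integrating against lebesgue_measure or its completion is the same. *)
Definition modular phi w gamma (f : L0 gamma) : \bar R :=
  \int[lebesgue_measure]_(t in itvI gamma)
    (orlicz_ext phi (rearr f t) * (w t)%:E).

Definition orlicz_lorentz gamma phi w : set (L0 gamma) :=
  [set f | exists2 k : R, (0 < k)%R & modular phi w (k *: f)%R < +oo].

Definition luxemburg gamma phi w (f : L0 gamma) : \bar R :=
  ereal_inf [set e%:E | e in
    [set e : R | (0 < e)%R /\ modular phi w (e^-1 *: f)%R <= 1]].

End orlicz_lorentz.
Arguments orlicz_lorentz {R} gamma phi w _.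

Section spaceability.
Context {R : realType} {V : lmodType R}.
Implicit Types (X A B M U : set V) (N : V -> \bar R) (opens : set (set V)).

Definition lin_indep B : Prop :=
  forall (s : seq V) (a : V -> R), uniq s -> [set` s] `<=` B ->
    \sum_(v <- s) a v *: v = 0 -> forall v, v \in s -> a v = 0.

Definition lin_gen B M : Prop :=
  forall v, M v -> exists (s : seq V) (a : V -> R),
    [set` s] `<=` B /\ v = \sum_(x <- s) a x *: x.

Definition hamel_basis B M : Prop :=
  [/\ B `<=` M, lin_indep B & lin_gen B M].

(* A cardinal is represented by any set C having that cardinality. *)
Definition has_dim M T (C : set T) : Prop :=
  exists2 B, hamel_basis B M & (B #= C)%card.

(* The ambient space is a subspace X of V, with the topology on X whose open
   sets are those in opens. *)
Definition spaceable X opens A T (C : set T) : Prop :=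
  exists M, [/\ submod_closed (mem M), M `<=` X, opens (X `\` M),
    has_dim M C & M `<=` A `|` [set 0]].

Definition maximal_spaceable X opens A : Prop :=
  exists2 B, hamel_basis B X & spaceable X opens A B.

Definition norm_open X N : set (set V) :=
  [set U | U `<=` X /\ forall f, U f ->
    exists2 e : R, 0 < e & forall g, X g -> (N (g - f)%R < e%:E)%E -> U g].

End spaceability.

(* Main.v *)
From HB Require Import structures.
Require Import Defs.
From mathcomp Require Import all_boot all_order all_algebra.
From mathcomp Require Import all_classical all_reals all_analysis.
From mathcomp Require Import measurable_realfun.
From mathcomp Require Import ring lra.

Set Implicit Arguments.
Unset Strict Implicit.
Unset Printing Implicit Defensive.
Import Order.TTheory GRing.Theory Num.Theory.
Import numFieldNormedType.Exports.

Local Open Scope classical_set_scope.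
Local Open Scope ring_scope.

(** The closed subspace consists of functions that are constant on each of
    countably many disjoint intervals.

    By (i) and (ii) no Lambda_phi_n contains Lambda_phi, so for every constant
    C the estimate phi_n(u/C) <= C phi(u) fails at some u > 0 (at arbitrarily
    large u when gamma is finite): otherwise it would compare the modulars and
    give the inclusion.  Write W(b) for the integral of w over ]0,b[.  As w is
    nonincreasing, W(2b) <= 2 W(b), so W takes values within a factor 2 of any
    prescribed small number, and for every n and i there are a height u_i and a
    width b_i with
      phi(u_i) W(2^(i+1) b_i) <= 2^-(i+1)  and  phi_n(u_i / 2^i) W(b_i) >= 2^i
    ([exists_step]).  The index n is read off from i as its 3-adic valuation,
    and the 2-adic valuation k(i) sorts the blocks into countably many
    families, so that every pair (k, n) occurs for infinitely many i.  The
    widths are small enough for disjoint intervals F_i of length b_i to fit in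
    I.  For a sequence a, let T a be a_{k(i)} u_i on F_i and 0 elsewhere, and
    let M be the set of all T a that belong to Lambda_phi.

    - M contains T a as soon as |a| <= 1/2.  The blocks i with
      2^(i+1) b_i <= t have total length at most t and are therefore negligible
      for the rearrangement at t; hence phi((T a)^*(t)) is at most the sum of
      the phi(u_i) over the i with t < 2^(i+1) b_i, and integrating against w
      bounds the modular of T a by 1 ([modular_step_le]).
    - If a_k <> 0 then T a is outside every Lambda_phi_n: for any scaling
      factor c, the blocks of type (k, n) give modulars of c T a at least 2^i
      for arbitrarily large i ([step_notin]).  In particular T is injective.
    - M is closed.  The Luxemburg norm controls convergence in measure
      ([luxemburg_small]), and the range of T is closed for convergence in
      measure because the value on each block is a limit of values
      ([step_closed]).
    - M is a subspace since Lambda_phi is one, which follows from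
      (f+g)^*(t) <= 2 max(f^*(t/2), g^*(t/2)) and from the boundedness of
      dilations, again because w is nonincreasing ([modular_max]).

    The geometric sequences with ratios in ]0,1[ are linearly independent, so M
    contains continuum many independent elements.  Conversely L0 itself has at
    most the cardinality of the continuum, a class being determined by the
    measures of its superlevel sets at rational levels inside intervals with
    rational endpoints ([L0_card_le]).  Extending the independent family to
    Hamel bases of M and of Lambda_phi shows that both have dimension
    continuum. *)

(** * Integrals of the weight *)

(** Superlevel sets of a monotone function are intervals. *)
Lemma noninc_emeasurable (R : realType) (D : set R) (G : R -> \bar R) :
  measurable D -> is_interval D ->
  (forall s t, D s -> D t -> s <= t -> (G t <= G s)%E) -> measurable_fun D G.
Proof.
move=> mD iD Gni; apply: (measurability _ (ErealGenOInfty.measurableE R)).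
move=> /= _ [_ [x ->]] <-; apply: is_interval_measurable => s t/=.
rewrite !in_itv/= !andbT => -[Ds xs] [Dt xt] u /andP[su ut].
have Du : D u by apply: (iD _ _ Ds Dt); rewrite su ut.
by split=> //; rewrite in_itv/= andbT (lt_le_trans xt)// Gni.
Qed.

Section weights.
Context {R : realType}.
Local Notation mu := (@lebesgue_measure R).

Definition Ipos (gamma : \bar R) : set R := [set t | 0 < t /\ (t%:E < gamma)%E].

Definition Ibelow (gamma : \bar R) (b : R) : set R :=
  [set t | Ipos gamma t /\ t < b].

Definition weight_int (gamma : \bar R) (w : R -> R) (b : R) : \bar R :=
  (\int[mu]_(t in Ibelow gamma b) (w t)%:E)%E.

Lemma Ipos_interval gamma : is_interval (Ipos gamma).
Proof.
move=> s t [s0 sg] [t0 tg] u /andP[su ut]; split; first exact: lt_le_trans su.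
by apply: le_lt_trans tg; rewrite lee_fin.
Qed.

Lemma Ibelow_interval gamma b : is_interval (Ibelow gamma b).
Proof.
move=> s t [Is sb] [It tb] u sut; split; first exact: Ipos_interval sut.
by case/andP: sut => _ /le_lt_trans; apply.
Qed.

Lemma measurable_Ipos gamma : measurable (Ipos gamma).
Proof. by apply: is_interval_measurable; exact: Ipos_interval. Qed.

Lemma measurable_Ibelow gamma b : measurable (Ibelow gamma b).
Proof. by apply: is_interval_measurable; exact: Ibelow_interval. Qed.

Lemma itvI_setD0 gamma : itvI gamma `\ 0 = Ipos gamma.
Proof.
apply/seteqP; split=> [t [[t0 tg] /eqP tN0]|t [t0 tg]].
  by split=> //; rewrite lt_neqAle eq_sym tN0.
by split; [split=> //; exact: ltW|apply/eqP; rewrite gt_eqF].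
Qed.

Section weight.
Context (gamma : \bar R) (w : R -> R).
Hypothesis gamma_gt0 : (0 < gamma)%E.
Hypothesis ww : weight_function gamma w.
Local Notation I := (Ipos gamma).
Local Notation J := (Ibelow gamma).
Local Notation W := (weight_int gamma w).

Lemma weight_gt0 t : I t -> 0 < w t.
Proof. by case: ww => w0 _ _ _ [t0 tg]; exact: w0. Qed.

Lemma weight_ge0 t : I t -> (0 <= (w t)%:E)%E.
Proof. by move=> It; rewrite lee_fin ltW// weight_gt0. Qed.

Lemma weight_ninc s t : I s -> I t -> s <= t -> w t <= w s.
Proof. by case: ww => _ wni _ _ [s0 _] [_ tg] st; exact: wni. Qed.

Lemma measurable_weight : measurable_fun I (EFin \o w).
Proof.
apply: noninc_emeasurable.
- exact: measurable_Ipos.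
- exact: Ipos_interval.
- by move=> s t Is It st; rewrite lee_fin weight_ninc.
Qed.

Lemma measurable_weight_sub (D : set R) :
  measurable D -> D `<=` I -> measurable_fun D (EFin \o w).
Proof.
move=> mD DI; apply: measurable_funS measurable_weight => //.
exact: measurable_Ipos.
Qed.

Lemma Ibelow_sub b : J b `<=` I. Proof. by move=> t []. Qed.

Lemma weight_int_ge0 b : (0 <= W b)%E.
Proof. by apply: integral_ge0 => t [It _]; exact: weight_ge0. Qed.

Lemma le_weight_int b c : b <= c -> (W b <= W c)%E.
Proof.
move=> bc; apply: ge0_subset_integral.
- exact: measurable_Ibelow.
- exact: measurable_Ibelow.
- exact: (measurable_weight_sub (measurable_Ibelow _ _) (@Ibelow_sub _)).
- by move=> t [It _]; exact: weight_ge0.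
- by move=> t [It tb]; split=> //; exact: lt_le_trans bc.
Qed.

(** The part of the integral over [b, 2b[ is at most b w(b), and b w(b) is at
    most the integral over ]0, b[. *)
Lemma weight_int_double b : 0 < b -> (W (2 * b) <= 2%:E * W b)%E.
Proof.
move=> b0.
have [bg|gb] := ltP b%:E gamma; last first.
  rewrite (_ : W (2 * b) = W b); first by rewrite lee_pemull ?weight_int_ge0// lee_fin ler1n.
  congr (integral _ _ _); apply/seteqP; split=> [t [It tb]|t [It tb]]; split=> //.
    by case: It => _ tg; have := lt_le_trans tg gb; rewrite lte_fin.
  by rewrite (lt_le_trans tb)// ler_peMl ?ler1n// ltW.
have Ib : I b by split.
pose B := J (2 * b) `&` [set t | b <= t].
have mB : measurable B.
  apply: measurableI; first exact: measurable_Ibelow.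
  rewrite (_ : [set t | b <= t] = `[b, +oo[%classic); first exact: measurable_itv.
  by apply/seteqP; split=> t /=; rewrite in_itv/= andbT.
have -> : W (2 * b) = (W b + \int[mu]_(t in B) (w t)%:E)%E.
  rewrite -ge0_integral_setU//.
  - congr (integral _ _ _); apply/seteqP; split=> [t [It tb]|t [[It tb]|[[It tb] _]]]; [|split=> //|by split].
      by have [bt|tb'] := leP b t; [right|left].
    by rewrite (lt_le_trans tb)// ler_peMl ?ler1n// ltW.
  - exact: measurable_Ibelow.
  - apply: measurable_weight_sub; first by apply: measurableU => //; exact: measurable_Ibelow.
    by move=> t [[]//|[[]//]].
  - by move=> t [[/weight_ge0]//|[[/weight_ge0]//]].
  - rewrite disj_set2E; apply/eqP; rewrite -subset0 => t [[_ tb] [_ /=]].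
    by rewrite leNgt tb.
rewrite (_ : 2%:E = 1 + 1)%E// ge0_muleDl ?lee01// mul1e leeD2l//.
have muB : (mu B <= b%:E)%E.
  rewrite (@le_trans _ _ (mu `[b, 2 * b[))//.
    apply: le_measure; rewrite ?inE//.
    by move=> t [[_ tb] /= bt]; rewrite in_itv/= bt tb.
  by rewrite lebesgue_measure_itv/= lte_fin; case: ifP => _; rewrite -?EFinB lee_fin; lra.
have muJ : (b%:E <= mu (J b))%E.
  rewrite (@le_trans _ _ (mu `]0, b[))//.
    by rewrite lebesgue_measure_itv/= lte_fin b0 oppr0 adde0.
  apply: le_measure; rewrite ?inE//.
    exact: measurable_Ibelow.
  move=> t /=; rewrite in_itv/= => /andP[t0 tb]; split=> //; split=> //.
  by apply: lt_trans bg; rewrite lte_fin.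
apply: (@le_trans _ _ ((w b)%:E * b%:E)%E).
  apply: (@le_trans _ _ (\int[mu]_(t in B) cst (w b)%:E t)%E).
    apply: ge0_le_integral => //.
    - by move=> t [[/weight_ge0]].
    - by apply: measurable_weight_sub => // t [[]].
    - by move=> t [[It tb] bt]; rewrite lee_fin weight_ninc.
  by rewrite integral_cst// lee_wpmul2l// weight_ge0.
apply: (@le_trans _ _ (\int[mu]_(t in J b) cst (w b)%:E t)%E).
  rewrite integral_cst//; last exact: measurable_Ibelow.
  by rewrite lee_wpmul2l// weight_ge0.
apply: ge0_le_integral => //.
- exact: measurable_Ibelow.
- by move=> t _; exact: weight_ge0.
- exact: (measurable_weight_sub (measurable_Ibelow _ _) (@Ibelow_sub _)).
- by move=> t [It tb]; rewrite lee_fin weight_ninc// ltW.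
Qed.

Lemma weight_int_pow2 n b : 0 < b -> (W (2 ^+ n * b) <= (2 ^+ n)%:E * W b)%E.
Proof.
move=> b0; elim: n => [|n ih]; first by rewrite expr0 mul1r mul1e.
rewrite exprS -mulrA (le_trans (weight_int_double _))// ?mulr_gt0 ?exprn_gt0//.
by rewrite EFinM -muleA lee_wpmul2l.
Qed.

(** When gamma is finite, b may exceed gamma; doubling then gives integrability
    up to gamma from integrability up to gamma / 2. *)
Lemma weight_int_lty b : (W b < +oo)%E.
Proof.
have W_in c : I c -> (W c < +oo)%E.
  move=> [c0 cg]; case: ww => _ _ /(_ c) + _.
  move=> /(_ (conj (ltW c0) cg)); apply: le_lt_trans.
  have cI : `]0, c] `<=` I.
    move=> t /=; rewrite in_itv/= => /andP[t0 tc]; split=> //.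
    by apply: le_lt_trans cg; rewrite lee_fin.
  apply: ge0_subset_integral.
  - exact: measurable_Ibelow.
  - exact: measurable_itv.
  - exact: (measurable_weight_sub (measurable_itv _) cI).
  - by move=> t /cI; exact: weight_ge0.
  - by move=> t [[t0 _] tc] /=; rewrite in_itv/= t0 ltW.
have [b0|b0] := leP b 0.
  rewrite /weight_int (_ : J b = set0) ?integral_set0//.
  by rewrite -subset0 => t [[t0 _] tb]; have := lt_trans t0 (lt_le_trans tb b0); rewrite ltxx.
have [bg|gb] := ltP b%:E gamma; first exact: W_in.
have gfin : gamma \is a fin_num.
  by rewrite ge0_fin_numE ?ltW// (le_lt_trans gb)// ltry.
pose g := fine gamma; have gE : gamma = g%:E by rewrite fineK.
have g0 : 0 < g by rewrite -lte_fin -gE.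
have Ig : I (g / 2) by split; [rewrite divr_gt0|rewrite gE lte_fin; lra].
apply: (@le_lt_trans _ _ (W (2 * (g / 2)))).
  apply: ge0_subset_integral.
  - exact: measurable_Ibelow.
  - exact: measurable_Ibelow.
  - exact: (measurable_weight_sub (measurable_Ibelow _ _) (@Ibelow_sub _)).
  - by move=> t [It _]; exact: weight_ge0.
  - move=> t [It _]; split=> //; rewrite mulrC divfK//.
    by rewrite -lte_fin -gE; case: It.
apply: (le_lt_trans (weight_int_double _)); first by rewrite divr_gt0.
by rewrite lte_mul_pinfty// W_in.
Qed.

Lemma weight_int_gt0 b : 0 < b -> (0 < W b)%E.
Proof.
move=> b0.
have [c [Ic cb]] : exists c, I c /\ c <= b.
  have [bg|gb] := ltP b%:E gamma; first by exists b.
  have gfin : gamma \is a fin_num.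
    by rewrite ge0_fin_numE ?ltW// (le_lt_trans gb)// ltry.
  pose g := fine gamma; have gE : gamma = g%:E by rewrite fineK.
  have g0 : 0 < g by rewrite -lte_fin -gE.
  move: gb; rewrite gE lee_fin => gb.
  exists (g / 2); split; last by lra.
  by split; [rewrite divr_gt0|rewrite lte_fin; lra].
have c0 : 0 < c by case: Ic.
apply: lt_le_trans (le_weight_int cb).
apply: (@lt_le_trans _ _ ((w c)%:E * c%:E)%E).
  by rewrite -EFinM lte_fin mulr_gt0// weight_gt0.
apply: (@le_trans _ _ (\int[mu]_(t in J c) cst (w c)%:E t)%E).
  rewrite integral_cst//; last exact: measurable_Ibelow.
  rewrite lee_wpmul2l// ?weight_ge0//.
  rewrite (@le_trans _ _ (mu `]0, c[))//.
    by rewrite lebesgue_measure_itv/= lte_fin c0 oppr0 adde0.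
  apply: le_measure; rewrite ?inE//.
    exact: measurable_Ibelow.
  move=> t /=; rewrite in_itv/= => /andP[t0 tb]; split=> //; split=> //.
  by case: Ic => _; apply: lt_trans; rewrite lte_fin.
apply: ge0_le_integral => //.
- exact: measurable_Ibelow.
- by move=> t _; exact: weight_ge0.
- exact: (measurable_weight_sub (measurable_Ibelow _ _) (@Ibelow_sub _)).
- by move=> t [It tb]; rewrite lee_fin weight_ninc// ltW.
Qed.

Lemma weight_int_fin_num b : W b \is a fin_num.
Proof. by rewrite ge0_fin_numE ?weight_int_lty// weight_int_ge0. Qed.

Lemma weight_int_unbounded (c : R) : gamma = +oo%E -> exists2 b, 0 < b & (c%:E < W b)%E.
Proof.
move=> gy; apply/not_exists2P => H.
have Wc n : (W n.+1%:R <= c%:E)%E.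
  have [|/negP] := H n.+1%:R; first by rewrite ltr0n.
  by rewrite -leNgt.
pose F (n : nat) := J n.+1%:R.
have FI : \bigcup_n F n = `]0, +oo[%classic.
  apply/seteqP; split=> [t [n _ [[t0 _] _]]|t /=]; first by rewrite /= in_itv/= t0.
  rewrite in_itv/= andbT => t0.
  exists (Num.truncn t); first by [].
  by split; [split=> //; rewrite gy ltry|rewrite truncnS_gt].
have : (\int[mu]_(t in F n) (w t)%:E @[n --> \oo] -->
        \int[mu]_(t in \bigcup_n F n) (w t)%:E)%E.
  apply: ge0_nondecreasing_set_cvg_integral.
  - move=> m n mn; rewrite subsetEset => t [It tm]; split=> //.
    by rewrite (lt_le_trans tm)// ler_nat.
  - by move=> n; exact: measurable_Ibelow.
  - by move=> n; exact: (measurable_weight_sub (measurable_Ibelow _ _) (@Ibelow_sub _)).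
  - by move=> n t [It _]; exact: weight_ge0.
rewrite FI; case: ww => _ _ _ /(_ gy) -> Wy.
have : (+oo <= c%:E)%E.
  apply: (cvge_le _ Wy); apply: nearW; exact: Wc.
by rewrite leye_eq.
Qed.

(** The integrals over [b / 2^n, b[ increase to the finite integral over
    ]0, b[. *)
Lemma weight_int_small b (c : R) : 0 < b -> 0 < c ->
  exists n, (W (b / 2 ^+ n) <= c%:E)%E.
Proof.
move=> b0 c0.
pose r n := b / 2 ^+ n.
have r_ge0 n : 0 <= r n by rewrite divr_ge0 ?exprn_ge0// ltW.
pose F n := J b `&` [set t | r n <= t].
have mF n : measurable (F n).
  apply: measurableI; first exact: measurable_Ibelow.
  rewrite (_ : [set t | r n <= t] = `[r n, +oo[%classic); first exact: measurable_itv.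
  by apply/seteqP; split=> t /=; rewrite in_itv/= andbT.
have rb n : r n <= b.
  by rewrite /r ler_pdivrMr ?exprn_gt0// ler_peMr ?exprn_ege1 ?ler1n// ltW.
have WF n : W b = (W (r n) + \int[mu]_(t in F n) (w t)%:E)%E.
  rewrite -ge0_integral_setU//.
  - congr (integral _ _ _); apply/seteqP; split=> [t [It tb]|t [[It tb]|[[It tb] _]]]; [|split=> //|by split].
      by have [bt|tb'] := leP (r n) t; [right|left].
    exact: lt_le_trans (rb n).
  - exact: measurable_Ibelow.
  - exact: mF.
  - apply: measurable_weight_sub; first by apply: measurableU => //; exact: measurable_Ibelow.
    by move=> t [[]//|[[]//]].
  - by move=> t [[/weight_ge0]//|[[/weight_ge0]//]].
  - rewrite disj_set2E; apply/eqP; rewrite -subset0 => t [[_ tb] [_ /=]].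
    by rewrite leNgt tb.
have FI : \bigcup_n F n = J b.
  apply/seteqP; split=> [t [n _ []]//|t Jt].
  have t0 : 0 < t by case: Jt => -[].
  exists (Num.truncn (b / t)) => //; split=> //=.
  rewrite /r ler_pdivrMr ?exprn_gt0// mulrC -ler_pdivrMr//.
  have /ltW/le_trans := truncnS_gt (b / t); apply.
  by rewrite -natrX ler_nat ltn_expl.
have : (\int[mu]_(t in F n) (w t)%:E @[n --> \oo] -->
        \int[mu]_(t in \bigcup_n F n) (w t)%:E)%E.
  apply: ge0_nondecreasing_set_cvg_integral => //.
  - move=> m n mn; rewrite subsetEset => t [It tm]; split=> //=.
    apply: le_trans tm; rewrite /r ler_pM2l// lef_pV2 ?posrE ?exprn_gt0//.
    by rewrite ler_weXn2l// ler1n.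
  - by move=> n; apply: measurable_weight_sub => // t [[]].
  - by move=> n t [[It _] _]; exact: weight_ge0.
rewrite FI => Fcvg.
apply/not_existsP => H.
have Fle n : (\int[mu]_(t in F n) (w t)%:E <= W b - c%:E)%E.
  rewrite leeBrDl// {1}(WF n) leeD2r//.
  rewrite leNgt; apply/negP => /ltW; exact: H.
have : (W b <= W b - c%:E)%E by apply: (cvge_le _ Fcvg); exact: nearW.
apply/negP; rewrite -ltNge lteBlDr// lteDl ?weight_int_fin_num// lte_fin//.
Qed.

(** Halving b until the integral first drops below c overshoots by a factor 2
    at most, by doubling; this replaces an intermediate value argument. *)
Lemma weight_int_choose b (c : R) : 0 < b -> 0 < c -> (c%:E < W b)%E ->
  exists b', [/\ 0 < b', b' <= b, (W b' <= c%:E)%E & (c%:E <= 2%:E * W b')%E].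
Proof.
move=> b0 c0 cW.
pose P n := (W (b / 2 ^+ n) <= c%:E)%E.
have exP : exists n, P n by exact: weight_int_small.
case: (ex_minnP exP) => -[|n] Pn nmin.
  by move: Pn; rewrite /P expr0 divr1 leNgt cW.
have bn0 k : 0 < b / 2 ^+ k by rewrite divr_gt0// exprn_gt0.
exists (b / 2 ^+ n.+1); split=> //.
  by rewrite ler_pdivrMr ?exprn_gt0// ler_peMr ?exprn_ege1 ?ler1n// ltW.
apply: le_trans (weight_int_double (bn0 _)).
rewrite (_ : 2 * (b / 2 ^+ n.+1) = b / 2 ^+ n); last first.
  by rewrite exprS invfM mulrCA mulVKf// mulrA.
rewrite leNgt; apply/negP => /ltW /nmin; by rewrite ltnn.
Qed.
End weight.
End weights.

(** * Orlicz functions *)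

Lemma half_add_le_max (R : realFieldType) (a b : R) :
  a / 2 + b / 2 <= Num.max a b.
Proof.
have : a <= Num.max a b by rewrite le_max lexx.
have : b <= Num.max a b by rewrite le_max lexx orbT.
lra.
Qed.

Section orlicz.
Context {R : realType}.
Implicit Types phi : R -> R.

Lemma orlicz_scale phi s u : orlicz_function phi -> 0 <= s <= 1 -> 0 <= u ->
  phi (s * u) <= s * phi u.
Proof.
case=> cvx phi0 _ _ /andP[s0 s1] u0.
have := cvx (Itv01 s0 s1) u 0; rewrite !inE/= !in_itv/= !andbT lexx.
move=> /(_ u0 isT); rewrite !convRE/= phi0 !mulr0 !addr0.
by rewrite /conv/= scaler0 addr0.
Qed.

Lemma orlicz_ge0 phi u : orlicz_function phi -> 0 <= u -> 0 <= phi u.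
Proof.
case=> _ phi0 _ phip; rewrite le_eqVlt => /orP[/eqP <-|/phip/ltW//].
by rewrite phi0.
Qed.

Lemma orlicz_le phi u v : orlicz_function phi -> 0 <= u -> u <= v ->
  phi u <= phi v.
Proof.
move=> phiO u0 uv.
have v0 : 0 <= v by exact: le_trans uv.
move: v0; rewrite le_eqVlt => /orP[/eqP v0|v0].
  by have -> : u = v by apply/eqP; rewrite eq_le uv -v0.
rewrite -{1}(divfK (lt0r_neq0 v0) u) (le_trans (orlicz_scale phiO _ (ltW v0)))//.
  by rewrite divr_ge0 ?(ltW v0)// ler_pdivrMr// mul1r.
by rewrite ler_piMl ?orlicz_ge0 ?(ltW v0)// ler_pdivrMr// mul1r.
Qed.

Lemma orlicz_unbounded phi (c : R) : orlicz_function phi ->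
  exists2 u, 0 < u & forall v, u <= v -> c < phi v.
Proof.
move=> phiO; have phi1 : 0 < phi 1 by case: phiO => _ _ _; apply.
pose u := Num.max 1 (c / phi 1 + 1).
have u1 : 1 <= u by rewrite le_max lexx.
have u0 : 0 < u by rewrite (lt_le_trans ltr01).
exists u => // v uv; apply: lt_le_trans (orlicz_le phiO (ltW u0) uv).
have : phi (u^-1 * u) <= u^-1 * phi u.
  apply: orlicz_scale => //; last exact: ltW.
  by rewrite invr_ge0 (ltW u0)/= invf_le1.
rewrite mulVf ?gt_eqF// mulrC ler_pdivlMr// => /(lt_le_trans _); apply.
rewrite mulrC -ltr_pdivrMr// lt_max; apply/orP; right.
by rewrite ltrDl.
Qed.

Local Open Scope ereal_scope.

Lemma orlicz_ext_ge0 phi x : orlicz_function phi -> 0 <= x ->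
  0 <= orlicz_ext phi x.
Proof. by move=> phiO; case: x => //= r; rewrite !lee_fin; exact: orlicz_ge0. Qed.

Lemma orlicz_ext_le phi x y : orlicz_function phi -> 0 <= x -> x <= y ->
  orlicz_ext phi x <= orlicz_ext phi y.
Proof.
move=> phiO; case: x => [x| |]//; case: y => [y| |]//=; rewrite ?leey//.
by rewrite !lee_fin => x0 xy; exact: orlicz_le.
Qed.

End orlicz.

(** * Distribution functions and rearrangements *)

Section rearrangement.
Context {R : realType}.
Implicit Types (gamma : \bar R) (t l : R).
Local Open Scope ereal_scope.

Lemma L0_measurable gamma (f : L0 gamma) :
  measurable_fun setT (f : lebesgueR -> R).
Proof. exact: measurable_funPT. Qed.

Lemma measurable_superlevel (f : @lebesgueR R -> R) l :
  measurable_fun setT f -> measurable [set t | (l < `|f t|)%R].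
Proof.
move=> mf.
have mnf : measurable_fun setT (@Num.norm _ R \o f) by exact: measurableT_comp.
rewrite (_ : [set t | _] = (@Num.norm _ R \o f) @^-1` `]l, +oo[%classic); last first.
  by apply/seteqP; split=> t /=; rewrite in_itv/= andbT.
by rewrite -[X in measurable X]setTI; exact: mnf.
Qed.

Lemma measurable_distr gamma (f : L0 gamma) l :
  measurable ([set t | (l < `|f t|)%R] : set lebesgueR).
Proof. exact/measurable_superlevel/L0_measurable. Qed.

Lemma distr_fun_le gamma (f : L0 gamma) l l' :
  (l <= l')%R -> distr_fun f l' <= distr_fun f l.
Proof.
move=> ll'; apply: le_measure; rewrite ?inE; [exact: measurable_distr..|].
by move=> t /=; exact: le_lt_trans.
Qed.

Lemma rearr_ge0 gamma (f : L0 gamma) t : 0 <= rearr f t.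
Proof. by apply: le_ereal_inf_tmp => _ [l [l0 _] <-]; rewrite lee_fin ltW. Qed.

Lemma rearr_le gamma (f : L0 gamma) t l :
  (0 < l)%R -> distr_fun f l <= t%:E -> rearr f t <= l%:E.
Proof. by move=> l0 fl; apply: ge_ereal_inf; exists l%:E => //; exists l. Qed.

Lemma rearr_ge gamma (f : L0 gamma) t (x : \bar R) :
  (forall l, (0 < l)%R -> distr_fun f l <= t%:E -> x <= l%:E) -> x <= rearr f t.
Proof. by move=> H; apply: le_ereal_inf_tmp => _ [l [l0 fl] <-]; exact: H. Qed.

Lemma rearr_lt gamma (f : L0 gamma) t l :
  rearr f t < l%:E -> distr_fun f l <= t%:E.
Proof.
move=> /ereal_inf_lt[_ [l' [_ fl'] <-]]; rewrite lte_fin => /ltW l'l.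
exact: le_trans (distr_fun_le f l'l) fl'.
Qed.

Lemma rearr_ninc gamma (f : L0 gamma) s t :
  (s <= t)%R -> rearr f t <= rearr f s.
Proof.
move=> st; apply: rearr_ge => l l0 fl; apply: rearr_le => //.
by rewrite (le_trans fl)// lee_fin.
Qed.

End rearrangement.

(** * Almost everywhere identities between classes *)

Section lebesgueI_ae.
Context {R : realType} (gamma : \bar R).
Local Open Scope ereal_scope.
Local Open Scope quotient_scope.

Lemma lebesgueI_aeS (P Q : R -> Prop) : (forall x, P x -> Q x) ->
  {ae lebesgueI gamma, forall x, P x} -> {ae lebesgueI gamma, forall x, Q x}.
Proof. by move=> PQ; apply: negligibleS => x /= nQ /PQ. Qed.

Lemma lebesgueI_aeS2 (P Q S : R -> Prop) : (forall x, P x -> Q x -> S x) ->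
  {ae lebesgueI gamma, forall x, P x} -> {ae lebesgueI gamma, forall x, Q x} ->
  {ae lebesgueI gamma, forall x, S x}.
Proof.
move=> PQS nP nQ; apply: negligibleS (negligibleU nP nQ) => x /= nS.
by apply/not_andP => -[Px Qx]; apply: nS; exact: PQS.
Qed.

Lemma lebesgueI_aeI (P Q : R -> Prop) : {ae lebesgueI gamma, forall x, P x} ->
  {ae lebesgueI gamma, forall x, Q x} ->
  {ae lebesgueI gamma, forall x, P x /\ Q x}.
Proof. exact: lebesgueI_aeS2. Qed.

Lemma lebesgueI_le_ae (A B : set (@lebesgueR R)) : measurable A -> measurable B ->
  {ae lebesgueI gamma, forall x, A x -> B x} -> lebesgueI gamma A <= lebesgueI gamma B.
Proof.
move=> mA mB [N [mN N0 sN]].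
apply: (@le_trans _ _ (lebesgueI gamma (B `|` N))).
  apply: le_measure; rewrite ?inE//; first exact: measurableU.
  move=> x Ax; have [Bx|nBx] := pselect (B x); [by left|right].
  by apply: sN => /= /(_ Ax).
have : lebesgueI gamma (B `|` N) <= lebesgueI gamma B + lebesgueI gamma N.
  exact: measureU2.
by rewrite [X in _ + X](_ : _ = 0) ?adde0.
Qed.

Lemma L0_piE (f : {mfun @lebesgueR R >-> R}) :
  {ae lebesgueI gamma, forall x, (\pi_(L0 gamma) f : L0 gamma) x = f x}.
Proof. by apply: filterS (aefun_reprP (lebesgueI gamma) f) => x; exact. Qed.

Lemma L0_addE (f g : L0 gamma) :
  {ae lebesgueI gamma, forall x, (f + g : L0 gamma)%R x = (f x + g x)%R}.
Proof.
have -> : (f + g = \pi_(L0 gamma) (repr f + repr g))%R.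
  by rewrite aefun_pi_add !reprK.
exact: L0_piE.
Qed.

Lemma L0_scaleE (a : R) (f : L0 gamma) :
  {ae lebesgueI gamma, forall x, (a *: f : L0 gamma)%R x = (a * f x)%R}.
Proof.
have -> : (a *: f = \pi_(L0 gamma) (a *: (repr f : {mfun @lebesgueR R >-> R})))%R.
  by rewrite aefun_pi_scale !reprK.
exact: L0_piE.
Qed.

Lemma L0_0E : {ae lebesgueI gamma, forall x, (0%R : L0 gamma) x = 0%R}.
Proof.
have := L0_scaleE 0%R 0%R; rewrite scale0r.
by apply: lebesgueI_aeS => x ->; rewrite mul0r.
Qed.

Lemma L0_eq (f g : L0 gamma) :
  {ae lebesgueI gamma, forall x, f x = g x} -> f = g.
Proof.
move=> fg; rewrite -[f]reprK -[g]reprK; apply: aefun_piP.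
by move: fg; apply: lebesgueI_aeS => x fgx _; exact: fgx.
Qed.

End lebesgueI_ae.

(** * The modular *)

(** The two set functions agree on half-open intervals. *)
Lemma lebesgue_measure_half (R : realType) (A : set R) : measurable A ->
  pushforward lebesgue_measure
    ((fun t => 2^-1 * t) : R -> measurableTypeR R) A =
  mscale (NngNum (ler0n R 2)) (@lebesgue_measure R) A.
Proof.
move=> mA.
pose s (t : measurableTypeR R) : measurableTypeR R := (2^-1 * t)%R.
have ms : measurable_fun setT s by exact: mulrl_measurable.
pose sm : {mfun measurableTypeR R >-> measurableTypeR R} :=
  HB.pack s (isMeasurableFun.Build _ _ _ _ _ ms).
have h0 : 0 <= 2^-1 :> R by rewrite invr_ge0.
pose nu := mscale (NngNum h0) (pushforward (@lebesgue_measure R) sm).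
have nuE : forall X : set R, ocitv X -> lebesgue_measure X = nu ms X.
  move=> _ [[a b] _ <-].
  rewrite /nu /mscale/= /pushforward.
  have -> : sm @^-1` `]a, b] = `](2 * a), (2 * b)]%classic.
    apply/seteqP; split=> t /=; rewrite !in_itv/= /s => /andP[at_ tb]; apply/andP; split; lra.
  rewrite !lebesgue_measure_itv/= !lte_fin ltr_pM2l//.
  by case: ifP => _; rewrite ?mule0// -!EFinD -EFinM; congr EFin; lra.
have := lebesgue_measure_unique nuE mA.
rewrite /nu /mscale/= => ->.
by rewrite muleA -EFinM mulfV ?mul1e.
Qed.

Section modular.
Context {R : realType} (gamma : \bar R) (w : R -> R).
Hypothesis gamma_gt0 : (0 < gamma)%E.
Hypothesis ww : weight_function gamma w.
Implicit Types (phi psi : R -> R) (f g h : L0 gamma).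
Local Notation mu := (@lebesgue_measure R).
Local Notation I := (Ipos gamma).
Local Notation J := (Ibelow gamma).
Local Notation W := (weight_int gamma w).
Local Open Scope ereal_scope.

Let H phi f t := orlicz_ext phi (rearr f t) * (w t)%:E.

Lemma measurable_orlicz_rearr phi f (c : R) (D : set R) : orlicz_function phi ->
  (0 <= c)%R -> measurable D ->
  measurable_fun D (fun t => orlicz_ext phi (rearr f (c * t)%R)).
Proof.
move=> phiO c0 mD; apply: (@measurable_funS _ _ _ _ setT) => //.
apply: noninc_emeasurable => // s t _ _ st.
by rewrite orlicz_ext_le ?rearr_ge0// rearr_ninc// ler_wpM2l.
Qed.

Lemma measurable_modular phi f (c : R) (D : set R) : orlicz_function phi ->
  (0 <= c)%R -> measurable D -> D `<=` I ->
  measurable_fun D (fun t => orlicz_ext phi (rearr f (c * t)%R) * (w t)%:E).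
Proof.
move=> phiO c0 mD DI; apply: emeasurable_funM.
  exact: measurable_orlicz_rearr.
exact: (measurable_weight_sub ww).
Qed.

Lemma modular_integrand_ge0 phi f (c t : R) : orlicz_function phi -> I t ->
  0 <= orlicz_ext phi (rearr f (c * t)%R) * (w t)%:E.
Proof.
move=> phiO It; apply: mule_ge0; first by rewrite orlicz_ext_ge0 ?rearr_ge0.
exact: (weight_ge0 ww).
Qed.

(** The origin, where w is unconstrained, is a null set; on the rest of I the
    integrand is measurable and nonnegative. *)
Lemma modularE phi f : orlicz_function phi -> modular phi w f =
  \int[mu]_(t in I) (orlicz_ext phi (rearr f t) * (w t)%:E).
Proof.
move=> phiO; rewrite /modular -(@integral_setD1 _ _ 0%R) itvI_setD0//.
  exact: measurable_Ipos.
under eq_fun do rewrite -[X in rearr f X](mul1r).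
by apply: measurable_modular => //; exact: measurable_Ipos.
Qed.

Lemma measurable_modular1 phi f (D : set R) : orlicz_function phi ->
  measurable D -> D `<=` I ->
  measurable_fun D (fun t => orlicz_ext phi (rearr f t) * (w t)%:E).
Proof.
move=> phiO mD DI; under eq_fun do rewrite -[X in rearr f X](mul1r).
exact: measurable_modular.
Qed.

Lemma modular_ge0 phi f : orlicz_function phi -> 0 <= modular phi w f.
Proof.
move=> phiO; rewrite modularE//; apply: integral_ge0 => t It.
by rewrite -[X in rearr f X](mul1r) modular_integrand_ge0.
Qed.

(** A Chebyshev bound: the rearrangement of f is at least u on ]0, b[. *)
Lemma modular_ge phi f (u b : R) : orlicz_function phi -> (0 <= u)%R ->
  (forall l, (l < u)%R -> b%:E <= distr_fun f l) ->
  (phi u)%:E * W b <= modular phi w f.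
Proof.
move=> phiO u0 fb; rewrite modularE// -ge0_integralZl_EFin//; last 4 first.
- exact: measurable_Ibelow.
- by move=> t [It _]; exact: (weight_ge0 ww).
- apply: (measurable_weight_sub ww); [exact: measurable_Ibelow|exact: Ibelow_sub].
- exact: orlicz_ge0.
apply: (@le_trans _ _ (\int[mu]_(t in J b) H phi f t)); last first.
  apply: ge0_subset_integral.
  - exact: measurable_Ibelow.
  - exact: measurable_Ipos.
  - by apply: measurable_modular1 => //; exact: measurable_Ipos.
  - by move=> t It; rewrite /H -[X in rearr f X](mul1r) modular_integrand_ge0.
  - exact: Ibelow_sub.
apply: ge0_le_integral.
- exact: measurable_Ibelow.
- by move=> t [It _]; rewrite mule_ge0 ?(weight_ge0 ww)// lee_fin orlicz_ge0.
- apply: emeasurable_funM => //.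
  exact: (measurable_weight_sub ww (measurable_Ibelow _ _) (@Ibelow_sub _ _ _)).
- exact: (measurable_modular1 _ phiO (measurable_Ibelow _ _) (@Ibelow_sub _ _ _)).
move=> t [It tb]; rewrite lee_wpmul2r ?(weight_ge0 ww)//.
rewrite -[(phi u)%:E]/(orlicz_ext phi u%:E) orlicz_ext_le//.
apply: rearr_ge => l l0 fl; rewrite lee_fin leNgt; apply/negP => /fb bl.
by have := le_trans bl fl; rewrite lee_fin leNgt tb.
Qed.

(** Replacing w(t) by the larger w(t/2) turns the left integrand into a dilation
    of the right one, and a dilation by 2 doubles the integral. *)
Lemma dilation_integral (G : R -> \bar R) :
  (forall t, 0 <= G t) -> measurable_fun setT G ->
  \int[mu]_(t in I) (G (2^-1 * t)%R * (w t)%:E) <=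
    2%:E * \int[mu]_(t in I) (G t * (w t)%:E).
Proof.
move=> G0 mG.
pose s (t : measurableTypeR R) : measurableTypeR R := (2^-1 * t)%R.
have ms : measurable_fun setT s by exact: mulrl_measurable.
have mI := @measurable_Ipos R gamma.
have mGs : measurable_fun setT (G \o s) by exact: measurableT_comp.
have sI t : I t -> I (s t).
  move=> [t0 tg]; split; first by rewrite /s mulr_gt0// invr_gt0.
  by apply: le_lt_trans tg; rewrite lee_fin /s ler_piMl ?ltW// invf_lt1// ltr1n.
have mGw : measurable_fun I (fun t => G t * (w t)%:E).
  apply: emeasurable_funM; first exact: measurable_funS mG.
  exact: (measurable_weight_sub ww).
have msI : measurable (s @^-1` I) by rewrite -[X in measurable X]setTI; exact: ms.
have mGws : measurable_fun (s @^-1` I) ((fun t => G t * (w t)%:E) \o s).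
  by apply: (measurable_comp mI) => //; [move=> _ [t + <-]|exact: measurable_funS ms].
apply: (@le_trans _ _ (\int[mu]_(t in s @^-1` I) ((fun t => G t * (w t)%:E) \o s) t)).
  apply: (@le_trans _ _ (\int[mu]_(t in I) ((fun t => G t * (w t)%:E) \o s) t)).
    apply: ge0_le_integral => //.
    - by move=> t It; rewrite mule_ge0// (weight_ge0 ww).
    - apply: emeasurable_funM; first exact: measurable_funS mGs.
      exact: (measurable_weight_sub ww).
    - exact: measurable_funS mGws.
    - move=> t It; rewrite /= lee_wpmul2l// lee_fin (weight_ninc ww)//; first exact: sI.
      by rewrite /s ler_piMl ?(ltW It.1)// ltW// invf_lt1// ltr1n.
  apply: ge0_subset_integral => //.
  by move=> t It; rewrite mule_ge0//= (weight_ge0 ww).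
rewrite -ge0_integral_pushforward//=; last first.
  by move=> y; rewrite inE => Iy; rewrite mule_ge0// (weight_ge0 ww).
pose c2 : {nonneg R} := NngNum (ler0n R 2).
rewrite (@eq_measure_integral _ _ _ _ (mscale c2 mu)); last first.
  by move=> A mA _; exact: lebesgue_measure_half.
rewrite ge0_integral_mscale//.
by move=> x Ix; rewrite mule_ge0// (weight_ge0 ww).
Qed.

Lemma distr_fun_max f g h l :
  {ae lebesgueI gamma, forall x, (`|h x| <= Num.max `|f x| `|g x|)%R} ->
  distr_fun h l <= distr_fun f l + distr_fun g l.
Proof.
move=> hfg.
apply: (@le_trans _ _ (lebesgueI gamma
    ([set t | (l < `|f t|)%R] `|` [set t | (l < `|g t|)%R]))).
  apply: lebesgueI_le_ae => //; first exact: measurable_distr.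
    by apply: measurableU; exact: measurable_distr.
  move: hfg; apply: lebesgueI_aeS => x hx /= lh; apply/orP; rewrite -lt_max.
  exact: lt_le_trans hx.
by apply: measureU2; exact: measurable_distr.
Qed.

(** Each of f and g exceeds a level above the maximum on a set of measure at
    most t/2, so h does so on a set of measure at most t. *)
Lemma rearr_max f g h t :
  {ae lebesgueI gamma, forall x, (`|h x| <= Num.max `|f x| `|g x|)%R} ->
  rearr h t <= maxe (rearr f (2^-1 * t)%R) (rearr g (2^-1 * t)%R).
Proof.
move=> hfg; rewrite leNgt; apply/negP.
set x := maxe _ _ => xh.
have x0 : 0 <= x by rewrite le_max rearr_ge0.
have [l xl lh] : exists2 l : R, x < l%:E & l%:E < rearr h t.
  have xfin : x \is a fin_num by rewrite ge0_fin_numE// (lt_le_trans xh)// leey.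
  move: xh; rewrite -(fineK xfin); move: (fine x) => y.
  case: (rearr h t) (rearr_ge0 h t) => [r| |]// _ xr.
    by exists ((y + r) / 2)%R; move: xr; rewrite !lte_fin; lra.
  by exists (y + 1)%R; rewrite ?ltry// lte_fin; lra.
have l0 : (0 < l)%R by rewrite -lte_fin (le_lt_trans x0).
move: xl; rewrite gt_max => /andP[/rearr_lt fl /rearr_lt gl].
have : rearr h t <= l%:E.
  apply: rearr_le => //; apply: (le_trans (distr_fun_max _ hfg)).
  by rewrite (le_trans (leeD fl gl))// -EFinD lee_fin; lra.
by rewrite leNgt lh.
Qed.

(** This quasi-triangle inequality replaces the triangle inequality of the norm:
    it gives both the stability of Lambda_phi under sums and under changes of
    scale. *)
Lemma modular_max phi f g h : orlicz_function phi ->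
  {ae lebesgueI gamma, forall x, (`|h x| <= Num.max `|f x| `|g x|)%R} ->
  modular phi w h <= 2%:E * (modular phi w f + modular phi w g).
Proof.
move=> phiO hfg.
have phi0 (e : L0 gamma) t : 0 <= orlicz_ext phi (rearr e t).
  by rewrite orlicz_ext_ge0// rearr_ge0.
have mI := @measurable_Ipos R gamma.
have mphi (e : L0 gamma) : measurable_fun setT (fun t => orlicz_ext phi (rearr e t)).
  under eq_fun do rewrite -[X in rearr e X](mul1r).
  by apply: measurable_orlicz_rearr.
have half0 : (0 <= 2^-1 :> R)%R by rewrite invr_ge0.
rewrite !modularE//.
apply: (@le_trans _ _ (\int[mu]_(t in I)
  (orlicz_ext phi (rearr f (2^-1 * t)%R) * (w t)%:E +
   orlicz_ext phi (rearr g (2^-1 * t)%R) * (w t)%:E))).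
  apply: ge0_le_integral => //.
  - by move=> t It; rewrite mule_ge0// (weight_ge0 ww).
  - exact: measurable_modular1.
  - by apply: emeasurable_funD; apply: measurable_modular.
  - move=> t It; rewrite -ge0_muleDl//.
    rewrite lee_wpmul2r ?(weight_ge0 ww)//.
    apply: (le_trans (orlicz_ext_le phiO (rearr_ge0 _ _) (rearr_max t hfg))).
    rewrite maxEle; case: ifP => _; [rewrite leeDr//|rewrite leeDl//].
rewrite ge0_integralD//; last 4 first.
- by move=> t It; rewrite modular_integrand_ge0.
- exact: measurable_modular.
- by move=> t It; rewrite modular_integrand_ge0.
- exact: measurable_modular.
rewrite ge0_muleDr; last 2 first.
- by apply: integral_ge0 => t It; rewrite mule_ge0// (weight_ge0 ww).
- by apply: integral_ge0 => t It; rewrite mule_ge0// (weight_ge0 ww).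
apply: leeD; exact: (dilation_integral (G := fun t => orlicz_ext phi (rearr _ t))).
Qed.

Lemma modular0 phi : orlicz_function phi -> modular phi w (0%R : L0 gamma) = 0.
Proof.
move=> phiO; rewrite modularE//; under eq_integral.
  move=> t; rewrite inE => -[t0 _].
  have -> : rearr (0%R : L0 gamma) t = 0.
    apply/eqP; rewrite eq_le rearr_ge0 andbT; apply/lee_addgt0Pr => e e0.
    rewrite add0e rearr_le//.
    apply: (@le_trans _ _ (lebesgueI gamma set0)); last by rewrite measure0 lee_fin ltW.
    apply: lebesgueI_le_ae => //; first exact: measurable_distr.
    have := L0_0E gamma; apply: lebesgueI_aeS => x /= ->.
    by rewrite normr0 ltNge (ltW e0).
  have -> : orlicz_ext phi 0 = 0 by case: phiO => /= _ ->.
  rewrite mul0e.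
  over.
by rewrite integral0.
Qed.

Lemma orlicz_lorentz0 phi : orlicz_function phi ->
  orlicz_lorentz gamma phi w 0%R.
Proof. by move=> phiO; exists 1%R => //; rewrite scaler0 modular0// ltry. Qed.

(** With c small compared with k and l, |c (a f + g)| is at most half the sum,
    hence at most the maximum, of |k f| and |l g|. *)
Lemma orlicz_lorentz_linear phi (a : R) f g : orlicz_function phi ->
  orlicz_lorentz gamma phi w f -> orlicz_lorentz gamma phi w g ->
  orlicz_lorentz gamma phi w (a *: f + g)%R.
Proof.
move=> phiO [k k0 fk] [l l0 gl].
have a1 : (0 < `|a| + 1)%R by rewrite ltr_wpDl.
pose c := Num.min (k / (2 * (`|a| + 1)))%R (l / 2)%R.
have c0 : (0 < c)%R by rewrite lt_min !divr_gt0// mulr_gt0.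
have ck : (c * `|a| <= k / 2)%R.
  apply: (@le_trans _ _ (k / (2 * (`|a| + 1)) * (`|a| + 1))%R).
    by rewrite ler_pM ?(ltW c0)// ?lerDl// ge_min lexx.
  by rewrite invfM mulrA divfK ?gt_eqF.
have cl : (c <= l / 2)%R by rewrite ge_min lexx orbT.
exists c; first exact: c0.
apply: (@le_lt_trans _ _
    (2%:E * (modular phi w (k *: f)%R + modular phi w (l *: g)%R))).
  apply: modular_max => //.
  have Ecf := L0_scaleE c (a *: f + g : L0 gamma)%R.
  have Eadd := L0_addE (a *: f : L0 gamma)%R g.
  have E1 := lebesgueI_aeI Ecf (lebesgueI_aeI Eadd (L0_scaleE a f)).
  have E2 := lebesgueI_aeI (L0_scaleE k f) (L0_scaleE l g).
  move: E1 E2; apply: lebesgueI_aeS2 => x [-> [-> ->]] [-> ->].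
  rewrite !normrM (gtr0_norm c0) (gtr0_norm k0) (gtr0_norm l0).
  apply: (@le_trans _ _ (k / 2 * `|f x| + l / 2 * `|g x|)%R).
    rewrite (le_trans (ler_wpM2l (ltW c0) (ler_normD _ _)))// mulrDr normrM mulrA.
    by rewrite lerD// ler_wpM2r.
  by rewrite !(mulrAC _ 2^-1%R) half_add_le_max.
apply: lte_mul_pinfty; [by rewrite lee_fin|by []|].
by apply: lte_add_pinfty; [exact: fk|exact: gl].
Qed.

Lemma total_weight_lty : gamma < +oo -> \int[mu]_(t in I) (w t)%:E < +oo.
Proof.
move=> gy; have gfin : gamma \is a fin_num by rewrite ge0_fin_numE// ltW.
apply: le_lt_trans (weight_int_lty gamma_gt0 ww (fine gamma)).
rewrite le_eqVlt; apply/orP; left; apply/eqP; congr integral.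
apply/seteqP; split=> t; last by case.
by move=> It; split=> //; rewrite -lte_fin fineK//; case: It.
Qed.

Lemma rearr_scale_le (c t : R) f : (0 < c)%R ->
  rearr (c *: f)%R t <= c%:E * rearr f t.
Proof.
move=> c0; case fr : (rearr f t) (rearr_ge0 f t) => [r| |]//; last first.
  by move=> _; rewrite gt0_muley ?leey// lte_fin.
rewrite lee_fin => r0; apply/lee_addgt0Pr => e e0.
have ec0 : (0 < e / c)%R by rewrite divr_gt0.
rewrite -EFinM -EFinD (_ : (c * r + e = c * (r + e / c))%R); last first.
  by rewrite mulrDr mulrCA divff ?mulr1// gt_eqF.
have /rearr_lt frec : rearr f t < (r + e / c)%:E by rewrite fr lte_fin ltrDl.
apply: rearr_le; first by rewrite mulr_gt0// ltr_wpDl.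
apply: le_trans frec; apply: lebesgueI_le_ae; [exact: measurable_distr..|].
have := L0_scaleE c f; apply: lebesgueI_aeS => x /= ->.
by rewrite normrM gtr0_norm// ltr_pM2l.
Qed.

(** The constant D is allowed on an interval of finite length only, where it
    contributes D times the finite total weight. *)
Lemma orlicz_lorentz_sub phi psi (C D : R) :
  orlicz_function phi -> orlicz_function psi -> (0 < C)%R -> (0 <= D)%R ->
  (gamma = +oo -> D = 0%R) ->
  (forall u, 0 <= u -> psi (C^-1 * u) <= C * phi u + D)%R ->
  orlicz_lorentz gamma phi w `<=` orlicz_lorentz gamma psi w.
Proof.
move=> phiO psiO C0 D0 Dy psiphi f [k k0 fk].
have Ci0 : (0 < C^-1)%R by rewrite invr_gt0.
exists (C^-1 * k)%R; first exact: mulr_gt0.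
rewrite -scalerA; move: (k *: f)%R fk => {k k0}{}f fk.
have mI := @measurable_Ipos R gamma.
have extle x : 0 <= x ->
    orlicz_ext psi ((C^-1)%:E * x) <= C%:E * orlicz_ext phi x + D%:E.
  case: x => [x| |]//=; rewrite ?lee_fin; first exact: psiphi.
  by move=> _; rewrite !gt0_muley.
apply: (@le_lt_trans _ _ (C%:E * modular phi w f + D%:E * \int[mu]_(t in I) (w t)%:E)).
  rewrite !modularE// -!ge0_integralZl_EFin//; last 5 first.
  - by move=> t It; rewrite (weight_ge0 ww).
  - exact: (measurable_weight_sub ww).
  - by move=> t It; rewrite -[X in rearr f X](mul1r) modular_integrand_ge0.
  - exact: measurable_modular1.
  - exact: ltW.
  rewrite -ge0_integralD//; last 4 first.
  - by move=> t It; rewrite mule_ge0 ?lee_fin ?(ltW C0)// -[X in rearr f X](mul1r) modular_integrand_ge0.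
  - by apply: emeasurable_funM => //; exact: measurable_modular1.
  - by move=> t It; rewrite mule_ge0 ?(weight_ge0 ww).
  - by apply: emeasurable_funM => //; exact: (measurable_weight_sub ww).
  apply: ge0_le_integral => //.
  - by move=> t It; rewrite -[X in rearr _ X](mul1r) modular_integrand_ge0.
  - exact: measurable_modular1.
  - apply: emeasurable_funD; apply: emeasurable_funM => //.
      exact: measurable_modular1.
    exact: (measurable_weight_sub ww).
  move=> t It; rewrite muleA -ge0_muleDl; last 2 first.
  - by rewrite mule_ge0 ?lee_fin ?(ltW C0)// orlicz_ext_ge0// rearr_ge0.
  - by rewrite lee_fin.
  rewrite lee_wpmul2r ?(weight_ge0 ww)//.
  apply: le_trans (extle _ (rearr_ge0 _ _)).
  by rewrite orlicz_ext_le// ?rearr_ge0// rearr_scale_le.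
rewrite lte_add_pinfty//; first by rewrite lte_mul_pinfty// lee_fin ltW.
have [/Dy->|gy] := eqVneq gamma +oo; first by rewrite mul0e ltry.
by rewrite lte_mul_pinfty// total_weight_lty// ltey.
Qed.

End modular.

(** * Closedness in measure *)

(** The supremum of the left endpoints lies in all the intervals
    [x_n - r_n, x_n + r_n]. *)
Lemma nested_intervals (R : realType) (x r : nat -> R) (N : nat) :
  (forall m n, (N <= m)%N -> (N <= n)%N -> x m - r m <= x n + r n) ->
  exists d, forall n, (N <= n)%N -> `|d - x n| <= r n.
Proof.
move=> H; pose S := [set x n - r n | n in [set n | (N <= n)%N]].
have S0 : S !=set0 by exists (x N - r N); exists N => //=.
have Sub n : (N <= n)%N -> ubound S (x n + r n).
  by move=> Nn _ [m /= Nm <-]; exact: H.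
exists (sup S) => n Nn; rewrite ler_distlC; apply/andP; split.
  by rewrite lerBlDr; apply: ge_sup => //; exact: Sub.
rewrite -lerBlDr; apply: ub_le_sup; last by exists n.
by exists (x N + r N); exact: Sub.
Qed.

Section luxemburg.
Context {R : realType} (gamma : \bar R) (w phi : R -> R).
Hypothesis gamma_gt0 : (0 < gamma)%E.
Hypothesis ww : weight_function gamma w.
Hypothesis phiO : orlicz_function phi.
Local Open Scope ereal_scope.

(** If |h| > d on a set of measure more than d and h / e' has modular at most 1,
    then phi(d / e') W(d) <= 1, which bounds e' from below since phi is
    unbounded. *)
Lemma luxemburg_small (d : R) : (0 < d)%R -> exists2 e : R, (0 < e)%R &
  forall h : L0 gamma, luxemburg phi w h < e%:E -> distr_fun h d <= d%:E.
Proof.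
move=> d0; have Wd := weight_int_gt0 gamma_gt0 ww d0.
have Wfin := weight_int_fin_num gamma_gt0 ww d.
have o0 : (0 < fine (weight_int gamma w d))%R by rewrite fine_gt0// Wd weight_int_lty.
have [v v0 vphi] := orlicz_unbounded (fine (weight_int gamma w d))^-1 phiO.
exists (d / v)%R; first exact: divr_gt0.
move=> h /ereal_inf_lt[_ [e [e0 he] <-]]; rewrite lte_fin => ev.
rewrite leNgt; apply/negP => dh.
have ve : (v <= d / e)%R.
  by rewrite ler_pdivlMr// mulrC -ler_pdivlMr// ltW.
have : (phi (d / e))%:E * weight_int gamma w d <= 1.
  apply: le_trans he; apply: modular_ge => //.
    by rewrite divr_ge0 ?ltW.
  move=> l lde; apply: (le_trans (ltW dh)).
  apply: lebesgueI_le_ae; [exact: measurable_distr..|].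
  have := L0_scaleE e^-1%R h; apply: lebesgueI_aeS => x /= -> dhx.
  rewrite normrM gtr0_norm ?invr_gt0//; apply: (lt_le_trans lde).
  by rewrite mulrC ler_wpM2l ?invr_ge0 ?ltW.
rewrite -(fineK Wfin) -EFinM lee_fin => H.
by have := vphi _ ve; rewrite ltNge -(ler_pM2r o0) mulVf ?gt_eqF// H.
Qed.

End luxemburg.

(** * Functions constant on disjoint cells *)

Section step.
Context {R : realType} (gamma : \bar R).
Variables (F : nat -> set (@lebesgueR R)) (b : nat -> R).
Hypothesis mF : forall i, measurable (F i).
Hypothesis tF : trivIset setT F.
Hypothesis b_gt0 : forall i, 0 < b i.
Hypothesis muF : forall i, lebesgueI gamma (F i) = (b i)%:E.
Implicit Types (c d : nat -> R) (t : R).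

Definition step c (t : @lebesgueR R) : R :=
  if pselect (exists i, F i t) is left H then c (projT1 (cid H)) else 0.

Lemma stepE c i t : F i t -> step c t = c i.
Proof.
move=> Fit; rewrite /step; case: pselect => [H|[]]; last by exists i.
by case: cid => j /= Fjt; congr c; apply: tF => //; exists t.
Qed.

Lemma step_out c t : ~ (exists i, F i t) -> step c t = 0.
Proof. by move=> nF; rewrite /step; case: pselect. Qed.

Lemma measurable_step c : measurable_fun setT (step c : @lebesgueR R -> R).
Proof.
move=> _ B mB; rewrite setTI.
have mU : measurable (\bigcup_(i in [set i | B (c i)]) F i).
  by apply: bigcup_measurable => i _; exact: mF.
have mC : measurable (~` \bigcup_i F i).
  by apply: measurableC; apply: bigcup_measurable => i _; exact: mF.
rewrite (_ : _ @^-1` _ = (\bigcup_(i in [set i | B (c i)]) F i) `|`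
    (if `[< B 0 >] then ~` \bigcup_i F i else set0)).
  by apply: measurableU => //; case: ifP.
apply/seteqP; split=> t /=.
  have [[i Fit]|nF] := pselect (exists i, F i t).
    by rewrite (stepE _ Fit) => Bc; left; exists i.
  by rewrite step_out// => B0; right; rewrite asboolT// => -[i _ Fit]; apply: nF; exists i.
move=> [[i Bc Fit]|]; first by rewrite (stepE _ Fit).
case: ifPn => // /asboolP B0 nF; rewrite step_out// => -[i Fit].
by apply: nF; exists i.
Qed.

Definition step_mfun c : {mfun @lebesgueR R >-> R} :=
  HB.pack (step c) (isMeasurableFun.Build _ _ _ _ _ (measurable_step c)).

Definition step_class c : L0 gamma := (\pi_(L0 gamma) (step_mfun c))%qT.

Lemma step_classE c :
  {ae lebesgueI gamma, forall t, step_class c t = step c t}.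
Proof. exact: L0_piE. Qed.

Lemma step_linear (x : R) c d t :
  step (fun i => x * c i + d i) t = x * step c t + step d t.
Proof.
have [[i Fit]|nF] := pselect (exists i, F i t); first by rewrite !(stepE _ Fit).
by rewrite !step_out// mulr0 addr0.
Qed.

Lemma step_class_linear (x : R) c d :
  step_class (fun i => x * c i + d i) = x *: step_class c + step_class d.
Proof.
apply: L0_eq.
have := lebesgueI_aeI (step_classE c) (lebesgueI_aeI (step_classE d)
  (step_classE (fun i => x * c i + d i))).
have := lebesgueI_aeI (L0_addE (x *: step_class c) (step_class d))
  (L0_scaleE x (step_class c)).
by apply: lebesgueI_aeS2 => t [-> ->] [-> [-> ->]]; rewrite step_linear.
Qed.

Lemma distr_step_ge c i l : l < `|c i| ->
  ((b i)%:E <= distr_fun (step_class c) l)%E.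
Proof.
move=> lc; rewrite -muF; apply: lebesgueI_le_ae => //; first exact: measurable_distr.
have := step_classE c; apply: lebesgueI_aeS => t /= -> Fit.
by rewrite (stepE _ Fit).
Qed.

(** Approximations of f within r_n outside a set of measure r_n have, on a given
    cell, values that differ by at most r_m + r_n, as soon as the exceptional
    sets are too small to cover the cell.  The limits of these values define the
    sequence a, and f differs from the resulting function by a fixed amount only
    on sets of measure at most r_n for all large n. *)
Lemma step_closed (k : nat -> nat) (u : nat -> R) (f : L0 gamma) :
  (forall n, exists i, k i = n) -> (forall i, 0 < u i) ->
  (forall e : R, 0 < e -> exists a : nat -> R,
     (distr_fun (step_class (fun i => a (k i) * u i) - f)%R e <= e%:E)%E) ->
  exists a : nat -> R, f = step_class (fun i => a (k i) * u i).
Proof.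
move=> ksurj u0 H.
pose r n : R := n.+1%:R^-1.
have r0 n : 0 < r n by rewrite invr_gt0.
have [a aP] := choice (fun n => H (r n) (r0 n)).
pose c n i := a n (k i) * u i.
pose E n := [set t : @lebesgueR R | r n < `|step (c n) t - f t|].
have mE n : measurable (E n).
  apply: measurable_superlevel; apply: measurable_funB.
    exact: measurable_step.
  exact: L0_measurable.
have muE n : (lebesgueI gamma (E n) <= (r n)%:E)%E.
  apply: le_trans (aP n); apply: lebesgueI_le_ae => //; first exact: measurable_distr.
  have := step_classE (c n).
  have := lebesgueI_aeI (L0_addE (step_class (c n)) (- f)) (L0_scaleE (-1) f).
  by apply: lebesgueI_aeS2 => t /=; rewrite scaleN1r mulN1r => -[-> ->] ->.
have r_small e : 0 < e -> exists N, forall n, (N <= n)%N -> r n < e.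
  move=> e0; exists (Num.truncn e^-1) => n Nn; rewrite /r invf_plt ?posrE//.
  by rewrite (lt_le_trans (truncnS_gt _))// ler_nat.
(* two approximations are compared at a point of the cell that both
   exceptional sets miss *)
have near i : exists2 N, (forall n, (N <= n)%N -> r n < b i) & forall m n, (N <= m)%N -> (N <= n)%N ->
    c m i - r m <= c n i + r n.
  have [N NP] := r_small (b i / 2) (divr_gt0 (b_gt0 i) (ltr0Sn _ 1)).
  exists N => [n /NP/lt_trans|m n Nm Nn]; first by apply; have := b_gt0 i; lra.
  have [t [Fit nE]] : exists t, F i t /\ ~ (E m `|` E n) t.
    apply: contrapT => /forallNP nF.
    have : ((b i)%:E <= (r m)%:E + (r n)%:E)%E.
      rewrite -muF (@le_trans _ _ (lebesgueI gamma (E m `|` E n)))//.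
        apply: le_measure; rewrite ?inE//; first exact: measurableU.
        by move=> t Fit; apply: contrapT => nE; apply: (nF t).
      apply: le_trans (leeD (muE m) (muE n)).
      exact: measureU2.
    by rewrite -EFinD lee_fin; have := NP _ Nm; have := NP _ Nn; lra.
  move: nE => /not_orP[/negP + /negP]; rewrite -!leNgt !(stepE _ Fit) !ler_distl.
  by move=> /andP[? ?] /andP[? ?]; lra.
(* the limit is read off on one cell of each family and then transported to
   the other cells of the family, at the cost of the factor u i / u j below *)
have lim j : exists x, exists2 i, k i = j & exists N, forall n, (N <= n)%N -> `|x - a n j| <= r n / u i.
  have [i kij] := ksurj j.
  have [N _ /nested_intervals[d dP]] := near i.
  exists (d / u i); exists i => //; exists N => n /dP.
  rewrite ler_pdivlMr// -[X in _ * X]gtr0_norm// -normrM mulrBl divfK ?gt_eqF//.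
  by rewrite /c kij.
have [x xP] := choice lim.
exists x; apply: L0_eq.
pose g := step (fun i => x (k i) * u i).
suff fg : {ae lebesgueI gamma, forall t, forall m, `|f t - g t| <= r m}.
  have := step_classE (fun i => x (k i) * u i); move: fg.
  apply: lebesgueI_aeS2 => t ft ->; apply/eqP; rewrite -subr_eq0 -normr_le0.
  rewrite leNgt; apply/negP => /r_small[N /(_ N (leqnn N))].
  by rewrite ltNge ft.
apply/ae_foralln => m.
pose B := [set t : @lebesgueR R | r m < `|f t - g t|].
have mB : measurable B.
  apply: measurable_superlevel; apply: measurable_funB; first exact: L0_measurable.
  exact: measurable_step.
have null C : measurable C ->
    (exists N, forall n, (N <= n)%N -> B `&` C `<=` E n) -> lebesgueI gamma (B `&` C) = 0%E.
  move=> mC [N CE]; apply/eqP; rewrite eq_le measure_ge0 andbT.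
  apply/lee_addgt0Pr => e e0; rewrite add0e.
  have [N' N'P] := r_small e e0.
  apply: (@le_trans _ _ (lebesgueI gamma (E (maxn N N')))).
    apply: le_measure; rewrite ?inE//; first exact: measurableI.
    by apply: CE; exact: leq_maxl.
  by rewrite (le_trans (muE _))// lee_fin ltW// N'P// leq_maxr.
have BF i : lebesgueI gamma (B `&` F i) = 0%E.
  apply: null => //.
  have [j kj [N NP]] := xP (k i).
  have [N' N'P] := r_small (r m / (1 + u i / u j)) (divr_gt0 (r0 m) (addr_gt0 ltr01 (divr_gt0 (u0 i) (u0 j)))).
  exists (maxn N N') => n; rewrite geq_max => /andP[/NP xn /N'P rn] t [/= Bt Fit].
  move: Bt; rewrite /E /B /g/= !(stepE _ Fit) => Bt.
  have : `|x (k i) * u i - c n i| <= r n * (u i / u j).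
    rewrite /c -mulrBl normrM (gtr0_norm (u0 i)) mulrCA mulrC ler_wpM2l ?(ltW (u0 i))//.
  move: rn; rewrite ltr_pdivlMr ?addr_gt0 ?divr_gt0// mulrDr mulr1 => rn xn'.
  have := ler_distD (c n i) (f t) (x (k i) * u i).
  by rewrite (distrC (f t) (c n i)) (distrC (c n i)); lra.
have Bout : lebesgueI gamma (B `&` ~` \bigcup_i F i) = 0%E.
  apply: null; first by apply: measurableC; exact: bigcup_measurable.
  have [N NP] := r_small (r m) (r0 m).
  exists N => n /NP rn t [/= + nF].
  have nF' : ~ exists i, F i t by move=> [i Fit]; apply: nF; exists i.
  by rewrite /E /B /g/= !step_out// subr0 sub0r normrN; exact: lt_trans.
have nB : (lebesgueI gamma).-negligible B.
  have -> : B = (B `&` ~` \bigcup_i F i) `|` \bigcup_i (B `&` F i).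
    by rewrite -setI_bigcupr -setIUr setUC setUv setIT.
  apply: negligibleU.
    apply/negligibleP => //; apply: measurableI => //.
    by apply: measurableC; exact: bigcup_measurable.
  apply: negligible_bigcup => i; apply/negligibleP; last exact: (BF i).
  exact: measurableI.
by apply: negligibleS nB => t /= /negP; rewrite -ltNge.
Qed.

Section step_modular.
Context (w : R -> R).
Hypothesis gamma_gt0 : (0 < gamma)%E.
Hypothesis ww : weight_function gamma w.
Local Notation mu := (@lebesgue_measure R).
Local Notation W := (weight_int gamma w).

(** The cells on which |c| may exceed l have length at most t / 2^(i+1), and
    these lengths add up to at most t. *)
Lemma distr_step_le c l t : 0 < l -> 0 <= t ->
  (forall i, t < 2 ^+ i.+1 * b i -> `|c i| <= l) ->
  (distr_fun (step_class c) l <= t%:E)%E.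
Proof.
move=> l0 t0 H.
pose F' i := if t < 2 ^+ i.+1 * b i then set0 else F i.
have mF' i : measurable (F' i) by rewrite /F'; case: ifP.
apply: (@le_trans _ _ (lebesgueI gamma (\bigcup_i F' i))).
  apply: lebesgueI_le_ae; first exact: measurable_distr.
    exact: bigcup_measurable.
  have := step_classE c; apply: lebesgueI_aeS => x /= ->.
  have [[i Fix]|nF] := pselect (exists i, F i x); last first.
    by rewrite step_out// normr0 ltNge (ltW l0).
  rewrite (stepE _ Fix) => lc; exists i => //; rewrite /F'; case: ifPn => //.
  by move=> /H; rewrite leNgt lc.
apply: (@le_trans _ _ (\sum_(0 <= i <oo) lebesgueI gamma (F' i))%E).
  by apply: measure_sigma_subadditive => //; exact: bigcup_measurable.
apply: le_trans (epsilon_trick0 xpredT t0).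
apply: lee_nneseries => [i _ _|i _]; first exact: measure_ge0.
rewrite /F'; case: ifPn => [_|]; first by rewrite measure0 lee_fin divr_ge0.
by rewrite -leNgt muF lee_fin ler_pdivlMr ?ltr0n ?expn_gt0// mulrC natrX.
Qed.

(** The factor 2 between |c| and u leaves room for an argument by contradiction:
    if phi of the rearrangement at t exceeded the sum of the phi(u_i) with
    t < 2^(i+1) b_i, then all these u_i would be smaller than the rearrangement
    x at t, so that on the corresponding cells |c_i| <= x / 2; but then the
    rearrangement at t would be at most x / 2. *)
Lemma modular_step_le phi (u c : nat -> R) : orlicz_function phi ->
  (forall i, 0 < u i) -> (forall i, `|c i| <= u i / 2) ->
  (modular phi w (step_class c) <=
    \sum_(0 <= i <oo) (phi (u i))%:E * W (2 ^+ i.+1 * b i))%E.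
Proof.
move=> phiO u0 cu.
have phiu0 i : (0 <= (phi (u i))%:E)%E by rewrite lee_fin orlicz_ge0// ltW.
have mI := @measurable_Ipos R gamma.
pose B i : set R := [set t | t < 2 ^+ i.+1 * b i].
have mB i : measurable (B i).
  by rewrite (_ : B i = `]-oo, 2 ^+ i.+1 * b i[%classic).
pose wB i := ((EFin \o w) \_ (B i))%E.
have wB0 i t : Ipos gamma t -> (0 <= wB i t)%E.
  by move=> It; rewrite /wB /patch; case: ifP => // _; exact: (weight_ge0 ww).
have mwB i : measurable_fun (Ipos gamma) (wB i).
  apply/(measurable_restrict _ (mB i) mI); apply: (measurable_weight_sub ww).
    exact: measurableI.
  exact: subIsetl.
have mG i : measurable_fun (Ipos gamma) (fun t => (phi (u i))%:E * wB i t)%E.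
  by apply: emeasurable_funM => //; exact: mwB.
have -> : (\sum_(0 <= i <oo) (phi (u i))%:E * W (2 ^+ i.+1 * b i) =
    \int[mu]_(t in Ipos gamma) \sum_(0 <= i <oo) ((phi (u i))%:E * wB i t))%E.
  rewrite integral_nneseries//; last first.
  - by move=> i t It; rewrite mule_ge0// wB0.
  apply: eq_eseriesr => i _; rewrite ge0_integralZl_EFin; last 4 first.
  - exact: mI.
  - by move=> t; exact: wB0.
  - exact: mwB.
  - by have := phiu0 i; rewrite lee_fin.
  by rewrite -integral_mkcondr.
rewrite modularE//; apply: ge0_le_integral => //.
- by move=> t It; rewrite -[X in rearr _ X](mul1r) (modular_integrand_ge0 ww).
- exact: (measurable_modular1 ww).
- apply: ge0_emeasurable_sum => //.
    by move=> i t It _; rewrite mule_ge0// wB0.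
  by move=> i _; exact: mG.
move=> t It.
pose S : \bar R := (\sum_(0 <= i <oo) if (t < 2 ^+ i.+1 * b i)%R then (phi (u i))%:E else 0)%E.
have S0 : (0 <= S)%E by apply: nneseries_ge0 => i _ _; case: ifP.
apply: (@le_trans _ _ (S * (w t)%:E)%E); last first.
  rewrite muleC -nneseriesZl//; last by move=> i _; case: ifP.
  apply: lee_nneseries => [i _ _|i _].
    by rewrite mule_ge0 ?(weight_ge0 ww)//; case: ifP.
  rewrite /wB /patch; case: ifPn => tB; first by rewrite mem_set//= muleC.
  by rewrite memNset ?mule0//; exact/negP.
rewrite lee_wpmul2r ?(weight_ge0 ww)// leNgt; apply/negP => Sphi.
have Sfin : S \is a fin_num by rewrite ge0_fin_numE// (lt_le_trans Sphi)// leey.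
have phiS i : t < 2 ^+ i.+1 * b i -> ((phi (u i))%:E <= S)%E.
  move=> ti; apply: le_trans (nneseries_lim_ge i.+1 _) => [|j _ _]; last by case: ifP.
  rewrite big_nat_recr//= ti leeDr// sume_ge0// => j _; by case: ifP.
have t0 : 0 <= t by case: It => /ltW.
case fE : (rearr (step_class c) t) (rearr_ge0 (step_class c) t) Sphi => [x| |]//=.
  rewrite lee_fin le_eqVlt => /orP[/eqP <-|x0].
    by case: phiO => _ -> _ _; rewrite ltNge S0.
  move=> Sx; have : (rearr (step_class c) t <= (x / 2)%:E)%E.
    apply: rearr_le; first by rewrite divr_gt0.
    apply: distr_step_le => //; first by rewrite divr_gt0.
    move=> i /phiS ti; rewrite (le_trans (cu i))// ler_pM2r// leNgt.
    apply/negP => /ltW xu; have := le_lt_trans ti Sx.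
    by rewrite lte_fin ltNge orlicz_le// ltW.
  by rewrite fE lee_fin; lra.
move=> _ _; have [v v0 vphi] := orlicz_unbounded (fine S) phiO.
have : (rearr (step_class c) t <= v%:E)%E.
  apply: rearr_le => //; apply: distr_step_le => // i /phiS ti.
  rewrite (le_trans (cu i))// leNgt; apply/negP => vu.
  have : v <= u i by have := u0 i; lra.
  by move/vphi; rewrite ltNge -lee_fin fineK// ti.
by rewrite fE leye_eq.
Qed.

(** On the cell i of the family j the function e T a has height
    e |a_j| u_i, which is at least u_i / 2^i for large i; the modular of e T a is
    therefore at least 2^i for arbitrarily large i. *)
Lemma step_notin psi (k : nat -> nat) (u a : nat -> R) (j : nat) :
  orlicz_function psi -> (forall i, 0 < u i) -> a j != 0 ->
  (forall m, exists i, [/\ (m <= i)%N, k i = j &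
     ((2 ^+ i)%:E <= (psi ((2 ^+ i)^-1 * u i))%:E * W (b i))%E]) ->
  ~ orlicz_lorentz gamma psi w (step_class (fun i => a (k i) * u i)).
Proof.
move=> psiO u0 aj H [e e0 fe].
have ea0 : 0 < e * `|a j| by rewrite mulr_gt0// normr_gt0.
set f := step_class _ in fe.
have modf0 := modular_ge0 ww (e *: f) psiO.
have mfin : modular psi w (e *: f) \is a fin_num by rewrite ge0_fin_numE.
pose M := Num.max (fine (modular psi w (e *: f))) (e * `|a j|)^-1.
have [i [Mi kij psii]] := H (Num.truncn M).+1.
have M0 : 0 <= M by rewrite le_max invr_ge0 (ltW ea0) orbT.
have Mi2 : M < 2 ^+ i.
  rewrite (lt_le_trans (truncnS_gt _))// -natrX ler_nat.
  by rewrite (leq_trans Mi)// ltnW// ltn_expl.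
have ui : (2 ^+ i)^-1 * u i <= e * `|a j| * u i.
  rewrite ler_pM2r// invf_ple ?posrE ?exprn_gt0//.
  by apply: ltW; apply: le_lt_trans Mi2; rewrite le_max lexx orbT.
have : ((2 ^+ i)%:E <= modular psi w (e *: f))%E.
  apply: (le_trans psii).
  apply: (@le_trans _ _ ((psi (e * `|a j| * u i))%:E * W (b i))%E).
    rewrite lee_wpmul2r ?(weight_int_ge0 ww)// lee_fin orlicz_le//.
    by rewrite mulr_ge0 ?invr_ge0 ?exprn_ge0 ?(ltW (u0 i)).
  apply: (modular_ge ww) => //; first by rewrite mulr_ge0 ?(ltW ea0) ?(ltW (u0 i)).
  move=> l le; apply: (@le_trans _ _ (distr_fun f (l / e))).
    apply: distr_step_ge.
    rewrite normrM kij (gtr0_norm (u0 i)) ltr_pdivrMr//.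
    by rewrite mulrC mulrA.
  apply: lebesgueI_le_ae; [exact: measurable_distr..|].
  have := L0_scaleE e f; apply: lebesgueI_aeS => t /= ->.
  by rewrite normrM (gtr0_norm e0) ltr_pdivrMr// mulrC.
rewrite -(fineK mfin) lee_fin leNgt => /negP; apply.
by apply: le_lt_trans Mi2; rewrite le_max lexx.
Qed.

End step_modular.
End step.

(** * Heights and widths of the blocks *)

Section choice_of_steps.
Context {R : realType} (gamma : \bar R) (w : R -> R).
Hypothesis gamma_gt0 : (0 < gamma)%E.
Hypothesis ww : weight_function gamma w.
Local Notation W := (weight_int gamma w).

(** If there were no such u, then phi and psi would satisfy the comparison that
    yields the excluded inclusion.  When gamma is finite, the bounded range of u
    where phi(u) <= D only adds a constant to this comparison. *)
Lemma exists_height phi psi (C D : R) :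
  orlicz_function phi -> orlicz_function psi -> 0 < C ->
  ~ (orlicz_lorentz gamma phi w `<=` orlicz_lorentz gamma psi w) ->
  exists u, [/\ 0 < u, C * phi u < psi (C^-1 * u) &
                ((gamma < +oo)%E -> D < phi u)].
Proof.
move=> phiO psiO C0 nsub; apply: contrapT => /forallNP H; apply: nsub.
have [v v0 vphi] := orlicz_unbounded D phiO.
have Ci0 : 0 <= C^-1 by rewrite invr_ge0 ltW.
have psiv0 : 0 <= psi (C^-1 * v) by rewrite orlicz_ge0// mulr_ge0// ltW.
have case u : 0 <= u -> psi (C^-1 * u) <= C * phi u \/
    ((gamma < +oo)%E /\ psi (C^-1 * u) <= psi (C^-1 * v)).
  rewrite le_eqVlt => /orP[/eqP <-|u0].
    by case: phiO psiO => _ + _ _ [_ + _ _]; rewrite !mulr0 => -> ->; rewrite mulr0; left.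
  have [|upsi] := leP (psi (C^-1 * u)) (C * phi u); [by left|right].
  have [gy|gy] := pselect (gamma < +oo)%E; last by exfalso; apply: (H u); split.
  split=> //; apply: orlicz_le => //; first by rewrite mulr_ge0// ltW.
  rewrite ler_wpM2l// leNgt; apply/negP => vu; apply: (H u); split=> // _.
  exact/vphi/ltW.
have [gy|gy] := pselect (gamma < +oo)%E.
  apply: (orlicz_lorentz_sub gamma_gt0 ww phiO psiO C0 psiv0).
    by move=> gE; move: gy; rewrite gE ltxx.
  move=> u u0; have [h|[_ h]] := case u u0.
    by rewrite (le_trans h)// lerDl.
  by rewrite (le_trans h)// lerDr mulr_ge0 ?orlicz_ge0// ltW.
apply: (orlicz_lorentz_sub gamma_gt0 ww phiO psiO C0 (lexx 0)) => // u u0.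
by rewrite addr0; have [|[]] := case u u0.
Qed.

(** The height u is taken from [exists_height] for a large constant C, and then b
    with W(b) within a factor 2 of c = 1 / (p^2 phi(u)), where p = 2^(i+1): the
    first estimate uses W(p b) <= p W(b), the second psi(u / C) > C phi(u).  The
    bound D makes c smaller than W(gamma / p), so that b fits into I. *)
Lemma exists_step phi psi (i : nat) :
  orlicz_function phi -> orlicz_function psi ->
  ~ (orlicz_lorentz gamma phi w `<=` orlicz_lorentz gamma psi w) ->
  exists u b : R, [/\ 0 < u, 0 < b, ((2 ^+ i.+1 * b)%:E <= gamma)%E,
    ((phi u)%:E * W (2 ^+ i.+1 * b) <= ((2 ^+ i.+1)^-1)%:E)%E &
    ((2 ^+ i)%:E <= (psi ((2 ^+ i)^-1 * u))%:E * W b)%E].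
Proof.
move=> phiO psiO nsub.
pose p : R := 2 ^+ i.+1.
have p0 : 0 < p by rewrite exprn_gt0.
pose C : R := 2 * p ^+ 2 * 2 ^+ i.
have C0 : 0 < C by rewrite !mulr_gt0 ?exprn_gt0.
pose g := fine gamma.
pose D := (p ^+ 2 * fine (W (g / p)))^-1.
have [u [u0 uC uD]] := exists_height D phiO psiO C0 nsub.
have phiu0 : 0 < phi u by case: phiO => _ _ _; apply.
pose c := (p ^+ 2 * phi u)^-1.
have c0 : 0 < c by rewrite invr_gt0 mulr_gt0// exprn_gt0.
have [b1 [b10 b1g cb1]] : exists b1, [/\ 0 < b1, ((p * b1)%:E <= gamma)%E & (c%:E < W b1)%E].
  have [gy|gy] := pselect (gamma < +oo)%E; last first.
    have gE : gamma = +oo%E.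
      by apply/eqP; rewrite -leye_eq leNgt; exact/negP.
    have [b1 b10 Wb1] := weight_int_unbounded ww c gE.
    by exists b1; split=> //; rewrite gE leey.
  have gfin : gamma \is a fin_num by rewrite ge0_fin_numE// ltW.
  have g0 : 0 < g by rewrite fine_gt0// gamma_gt0.
  have gp0 : 0 < g / p by rewrite divr_gt0.
  exists (g / p); split=> //.
    by rewrite mulrC divfK ?gt_eqF// fineK.
  have Wf := weight_int_fin_num gamma_gt0 ww (g / p).
  have W0 : 0 < fine (W (g / p)) by rewrite fine_gt0// weight_int_gt0// weight_int_lty.
  rewrite -(fineK Wf) lte_fin /c invf_plt ?posrE ?mulr_gt0 ?exprn_gt0//.
  by move: (uD gy); rewrite /D invfM ltr_pdivrMl ?exprn_gt0.
have [b [b0 bb1 Wbc cWb]] := weight_int_choose gamma_gt0 ww b10 c0 cb1.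
have Wf := weight_int_fin_num gamma_gt0 ww b.
exists u, b; split=> //.
- by apply: le_trans b1g; rewrite lee_fin ler_pM2l.
- apply: (@le_trans _ _ ((phi u)%:E * (p%:E * c%:E))%E).
    rewrite lee_wpmul2l ?lee_fin ?(ltW phiu0)//.
    apply: (le_trans (weight_int_pow2 ww i.+1 b0)).
    by rewrite lee_wpmul2l// lee_fin ltW.
  rewrite -!EFinM lee_fin /c -/p le_eqVlt; apply/orP; left; apply/eqP.
  by field; rewrite !gt_eqF.
move: cWb; rewrite -(fineK Wf) -!EFinM !lee_fin => cWb.
have Wb0 : 0 <= fine (W b) by rewrite fine_ge0// weight_int_ge0.
apply: (@le_trans _ _ (C * phi u * (c / 2))).
  rewrite /C /c le_eqVlt; apply/orP; left; apply/eqP.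
  by field; rewrite !gt_eqF.
apply: (@le_trans _ _ (psi (C^-1 * u) * fine (W b))).
  apply: ler_pM => //; [by rewrite mulr_ge0 ?(ltW C0) ?(ltW phiu0)|by rewrite divr_ge0 ?(ltW c0)|exact: ltW|].
  by rewrite ler_pdivrMr// mulrC.
rewrite ler_wpM2r// orlicz_le//.
  by rewrite mulr_ge0 ?invr_ge0 ?(ltW C0) ?(ltW u0).
rewrite ler_pM2r// lef_pV2 ?posrE ?exprn_gt0// /C ler_peMl ?exprn_ge0//.
have p1 : 1 <= p ^+ 2 by rewrite exprn_ege1// exprn_ege1// ler1n.
by rewrite (le_trans p1)// ler_peMl ?ler1n// (le_trans _ p1).
Qed.

(** The intervals are put side by side; when gamma is finite, the lengths are
    bounded by gamma / 2^(i+1) and hence fit into I. *)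
Lemma exists_cells (b : nat -> R) : (forall i, 0 < b i) ->
  (forall i, ((2 ^+ i.+1 * b i)%:E <= gamma)%E) ->
  exists F : nat -> set (@lebesgueR R), [/\ forall i, measurable (F i),
    trivIset setT F & forall i, lebesgueI gamma (F i) = (b i)%:E].
Proof.
move=> b0 bg.
pose s n := \sum_(j < n) b j.
have sS n : s n.+1 = s n + b n by rewrite /s big_ord_recr.
have s_ge0 n : 0 <= s n by rewrite sumr_ge0// => j _; exact: ltW.
have s_le m n : (m <= n)%N -> s m <= s n.
  elim: n => [|n ih]; first by rewrite leqn0 => /eqP ->.
  rewrite leq_eqVlt => /orP[/eqP -> //|]; rewrite ltnS => /ih/le_trans; apply.
  by rewrite sS lerDl ltW.
have sg n : ((s n)%:E <= gamma)%E.
  have [gy|gy] := pselect (gamma < +oo)%E; last first.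
    by rewrite (_ : gamma = +oo%E) ?leey//; apply/eqP; rewrite -leye_eq leNgt; exact/negP.
  have gfin : gamma \is a fin_num by rewrite ge0_fin_numE// ltW.
  have g0 : 0 < fine gamma by rewrite fine_gt0// gamma_gt0.
  rewrite -(fineK gfin) lee_fin.
  suff : s n + fine gamma / 2 ^+ n <= fine gamma.
    by apply: le_trans; rewrite lerDl divr_ge0 ?exprn_ge0// ltW.
  elim: n => [|n]; first by rewrite /s big_ord0 add0r expr0 divr1.
  apply: le_trans; rewrite sS -addrA lerD2l.
  have : b n <= fine gamma / 2 ^+ n.+1.
    by rewrite ler_pdivlMr ?exprn_gt0// mulrC -lee_fin fineK.
  have -> : fine gamma / 2 ^+ n.+1 = fine gamma / 2 ^+ n / 2.
    by rewrite exprS invfM mulrCA mulrC.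
  move: (_ / 2 ^+ n) => y; lra.
exists (fun i => `[s i, s i.+1[%classic); split.
- move=> i; apply: sub_caratheodory; exact: measurable_itv.
- apply/trivIsetP => i j _ _ ij; rewrite -subset0 => x /= [].
  rewrite !in_itv/= => /andP[six xsi] /andP[sjx xsj].
  move: ij; rewrite neq_ltn => /orP[/s_le ij|/s_le ij].
    by have := lt_le_trans xsi (le_trans ij sjx); rewrite ltxx.
  by have := lt_le_trans xsj (le_trans ij six); rewrite ltxx.
- move=> i.
  have -> : lebesgueI gamma `[s i, s i.+1[ = lebesgue_measure (`[s i, s i.+1[%classic : set R).
    rewrite /lebesgueI /mrestr.
    rewrite (_ : _ `&` _ = `[s i, s i.+1[%classic)//.
    apply/seteqP; split=> [x []//|x /= sx]; split=> //.
    move: sx; rewrite in_itv/= => /andP[six xsi]; split.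
      exact: le_trans six.
    by apply: lt_le_trans (sg i.+1); rewrite lte_fin.
  by rewrite lebesgue_measure_itv/= lte_fin sS ltrDl b0 -EFinB addrAC subrr add0r.
Qed.

End choice_of_steps.

(** * Hamel bases and independent families *)

Section hamel.
Context {R : realType} {V : lmodType R}.
Implicit Types (B S X : set V).

(** Zorn for the subsets of X that are independent together with S; the finite
    support of a linear relation lies in a single member of a chain. *)
Lemma hamel_extension S X : S `<=` X -> lin_indep S ->
  exists2 B, S `<=` B & hamel_basis B X.
Proof.
move=> SX Sind.
pose P B := B `<=` X /\ lin_indep (S `|` B).
have [|B [[BX Bind] Bmax]] := @Zorn_bigcup V P.
  move=> F FP Ftot; split=> [v [B /FP[BX _]]|]; first exact: BX.
  have fin (s : seq V) : [set` s] `<=` S `|` \bigcup_(B in F) B ->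
      exists2 B, B = set0 \/ F B & [set` s] `<=` S `|` B.
    elim: s => [_|v s ih sub]; first by exists set0; [left|move=> ?].
    have [x xs|B FB sB] := ih.
      by apply: sub => /=; rewrite inE xs orbT.
    have [vS|[B' FB' vB']] := sub v (mem_head _ _).
      exists B => // x /=; rewrite inE => /orP[/eqP ->|xs]; [by left|exact: sB].
    have [B0|FB0] := FB.
      exists B'; [by right|move=> x /=; rewrite inE => /orP[/eqP ->|xs]; first by right].
      by have [] := sB _ xs; [left|rewrite B0].
    have [BB|BB] := Ftot _ _ FB0 FB'.
      exists B'; [by right|move=> x /=; rewrite inE => /orP[/eqP ->|xs]; first by right].
      by have [] := sB _ xs; [left|move/BB; right].
    exists B; first by right.
    by move=> x /=; rewrite inE => /orP[/eqP ->|]; [right; exact: BB|exact: sB].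
  move=> s a us /fin[B [->|FB] sB]; first by apply: Sind => //; rewrite setU0 in sB.
  by apply: (FP _ FB).2.
exists (S `|` B); first by move=> v; left.
split=> //; first by move=> v [/SX|/BX].
move=> v Xv.
have [SBv|nSBv] := pselect ((S `|` B) v).
  exists [:: v], (fun=> 1); split; first by move=> x /=; rewrite inE => /eqP ->.
  by rewrite big_seq1 scale1r.
have BvP : ~ P (B `|` [set v]).
  apply: Bmax; split; first by move=> x; left.
  by move=> /(_ v (or_intror erefl)) Bv; apply: nSBv; right.
have : ~ lin_indep (S `|` (B `|` [set v])).
  by move=> ind; apply: BvP; split=> // x [/BX//|->].
move=> /existsNP[s] /existsNP[a] /not_implyP[us] /not_implyP[ss] /not_implyP[s0].
move=> /existsNP[y] /not_implyP[ys ay0].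
have sub (s' : seq V) : {subset s' <= s} -> v \notin s' -> [set` s'] `<=` S `|` B.
  move=> s's vs' x /= xs'; have [|[|xv]] := ss x (s's _ xs'); [by left|by right|].
  by move: vs'; rewrite -xv xs'.
have vs : v \in s.
  apply: contrapT => /negP vs; apply: ay0; apply: (Bind s a) => //.
  by apply: sub.
have sE : \sum_(x <- s) a x *: x = a v *: v + \sum_(x <- rem v s) a x *: x.
  by rewrite (perm_big _ (perm_to_rem vs)) big_cons.
have remP : [set` rem v s] `<=` S `|` B.
  by apply: sub; [exact: mem_rem|rewrite mem_rem_uniqF].
have av0 : a v != 0.
  apply/eqP => av0; apply: (ay0); apply: (Bind (rem v s) a) => //.
  - exact: rem_uniq.
  - by move: s0; rewrite sE av0 scale0r add0r.
  - rewrite mem_rem_uniq// inE ys andbT; apply/eqP => yv.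
    by apply: ay0; rewrite yv.
exists (rem v s), (fun x => - (a x / a v)); split=> //.
move: s0; rewrite sE => /eqP; rewrite addr_eq0 => /eqP s0.
apply: (scalerI av0); rewrite s0 scaler_sumr -sumrN; apply: eq_bigr => x _.
by rewrite scalerA mulrN mulrCA divff// mulr1 scaleNr.
Qed.

Lemma lin_indep_range (T : choiceType) (f : T -> V) :
  (forall (s : seq T) (c : T -> R), uniq s -> \sum_(x <- s) c x *: f x = 0 ->
     forall x, x \in s -> c x = 0) ->
  lin_indep (range f).
Proof.
move=> H s a us sf s0 v vs.
have [g gP] : exists g : V -> T, forall v, v \in s -> f (g v) = v.
  have [t0 _ _] := sf v vs.
  suff /choice[g gP] : forall y, exists t, y \in s -> f t = y by exists g.
  move=> y; have [ys|ys] := boolP (y \in s); last by exists t0.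
  by have [t _ ft] := sf y ys; exists t.
have := H (map g s) (a \o f); rewrite big_map => /(_ _ _ (g v)) /=.
rewrite gP//; apply.
- rewrite map_inj_in_uniq// => x y xs ys gxy.
  by rewrite -(gP x xs) gxy gP.
- by rewrite -[RHS]s0; apply: eq_big_seq => x xs; rewrite gP.
- exact: map_f.
Qed.

End hamel.

(** The relation extends from monomials to all polynomials, in particular to the
    one that vanishes at all points of s except x. *)
Lemma vandermonde (K : idomainType) (s : seq K) (c : K -> K) : uniq s ->
  (forall n, \sum_(x <- s) c x * x ^+ n = 0) -> forall x, x \in s -> c x = 0.
Proof.
move=> us H x xs.
have Hp (p : {poly K}) : \sum_(y <- s) c y * p.[y] = 0.
  under eq_bigr do rewrite horner_coef mulr_sumr.
  rewrite exchange_big/= big1// => i _.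
  under eq_bigr do rewrite mulrCA.
  by rewrite -mulr_sumr H mulr0.
have := Hp (\prod_(y <- rem x s) ('X - y%:P)).
rewrite (perm_big _ (perm_to_rem xs)) big_cons/= [X in _ + X]big_seq [X in _ + X]big1 ?addr0.
  move=> /eqP; rewrite mulf_eq0 => /orP[/eqP//|].
  by rewrite -rootE root_prod_XsubC mem_rem_uniqF.
by move=> y ys; have /rootP -> : root (\prod_(z <- rem x s) ('X - z%:P)) y; rewrite ?mulr0// root_prod_XsubC.
Qed.

(** * Cardinality of L0 *)

Lemma injective_card_le (T U : Type) (f : T -> U) (A : set T) (B : set U) :
  {in A &, injective f} -> (forall x, A x -> B (f x)) -> (A #<= B)%card.
Proof.
move=> finj fB; rewrite -(card_le_eql (inj_card_eq finj)).
by apply: subset_card_le => _ [x Ax <-]; exact: fB.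
Qed.

Lemma powerset_countable_card_le (T : countType) :
  ([set: set T] #<= [set: set nat])%card.
Proof.
apply: (@injective_card_le _ _ (fun X => pickle @` X)) => // X Y _ _.
move=> /seteqP[XY YX]; apply/seteqP; split=> x xX.
  have [y Yy /(pcan_inj pickleK) <-//] := XY _ (imageP pickle xX).
have [y Yy /(pcan_inj pickleK) <-//] := YX _ (imageP pickle xX).
Qed.

(** A set of naturals is mapped to a ternary expansion with digits 0 and 1, on
    which the lexicographic order agrees with the order of the reals. *)
Section powerset_nat.
Context {R : realType}.
Implicit Types X Y : set nat.

Let S X n : R := \sum_(i < n) (if `[< X i >] then (3 ^+ i)^-1 else 0).

Let S_recr X n : S X n.+1 = S X n + (if `[< X n >] then (3 ^+ n)^-1 else 0).
Proof. by rewrite /S big_ord_recr. Qed.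

Let S_tail X m n : (m <= n)%N -> S X n <= S X m + 3 / 2 * (3 ^+ m)^-1.
Proof.
move=> mn.
suff : S X n + 3 / 2 * (3 ^+ n)^-1 <= S X m + 3 / 2 * (3 ^+ m)^-1.
  by apply: le_trans; rewrite lerDl mulr_ge0 ?divr_ge0 ?invr_ge0 ?exprn_ge0.
elim: n mn => [|n ih]; first by rewrite leqn0 => /eqP ->.
rewrite leq_eqVlt => /orP[/eqP -> //|]; rewrite ltnS => /ih; apply: le_trans.
rewrite S_recr exprS invfM.
have : 0 <= (3 ^+ n)^-1 :> R by rewrite invr_ge0 exprn_ge0.
case: ifP => _; move: (_ ^-1) (S X n) => x y; lra.
Qed.

Let ternary X : R := sup (range (S X)).

Let has_sup_S X : has_sup (range (S X)).
Proof.
split; first by exists (S X 0), 0%N.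
by exists (S X 0 + 3 / 2 * (3 ^+ 0)^-1) => _ [n _ <-]; exact: S_tail.
Qed.

Let ternary_lt X Y i : (forall j, (j < i)%N -> `[< X j >] = `[< Y j >]) ->
  X i -> ~ Y i -> ternary Y < ternary X.
Proof.
move=> XY Xi nYi.
have Si : S X i = S Y i by apply: eq_bigr => j _; rewrite XY.
apply: (@lt_le_trans _ _ (S X i.+1)); last first.
  by apply: ub_le_sup; [exact: (has_sup_S X).2|exists i.+1].
apply: (@le_lt_trans _ _ (S Y i.+1 + 3 / 2 * (3 ^+ i.+1)^-1)).
  apply: ge_sup => [|_ [n _ <-]]; first by exists (S Y 0), 0%N.
  have [ni|ni] := leqP i.+1 n; first exact: S_tail.
  apply: (@le_trans _ _ (S Y i.+1)); last first.
    by rewrite lerDl mulr_ge0 ?divr_ge0 ?invr_ge0 ?exprn_ge0.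
  apply: (homo_leq (f := S Y) (r := fun x y => x <= y)) => //; last exact: ltnW.
    by move=> ? ? ? ; exact: le_trans.
  by move=> k; rewrite S_recr lerDl; case: ifP; rewrite // invr_ge0 exprn_ge0.
rewrite !S_recr Si (asboolT Xi) (asboolF nYi) exprS invfM addr0.
have : 0 < (3 ^+ i)^-1 :> R by rewrite invr_gt0 exprn_gt0.
move: (_ ^-1) (S Y i) => x y; lra.
Qed.

Lemma powerset_nat_card_le : ([set: set nat] #<= [set: R])%card.
Proof.
apply: (@injective_card_le _ _ ternary) => // X Y _ _ tXY.
apply: contrapT => XY.
have ex : exists i, `[< X i >] != `[< Y i >].
  apply: contrapT => /forallNP H; apply: XY; apply/seteqP; split=> i.
    by move=> /asboolP Xi; apply/asboolP; move: (H i) => /negP/negPn/eqP <-.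
  by move=> /asboolP Xi; apply/asboolP; move: (H i) => /negP/negPn/eqP ->.
case: (ex_minnP ex) => i Xi imin.
have low j : (j < i)%N -> `[< X j >] = `[< Y j >].
  by move=> ji; apply/eqP/negPn/negP => /imin; rewrite leqNgt ji.
have [iX|iX] := pselect (X i); have [iY|iY] := pselect (Y i).
- by move: Xi; rewrite !asboolT.
- by have := ternary_lt low iX iY; rewrite tXY ltxx.
- by have := ternary_lt (fun j ji => esym (low j ji)) iY iX; rewrite tXY ltxx.
- by move: Xi; rewrite !asboolF.
Qed.

End powerset_nat.

Section card_L0.
Context {R : realType}.
Local Notation mu := (@completed_lebesgue_measure R).
Local Open Scope ereal_scope.

(** Cover a bounded part S of A \ B by intervals J_k of total length less than
    the measure of S plus e.  As S avoids B, the hypothesis bounds the measure of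
    J_k inside S by that of J_k outside S; the latter measures add up to at most
    e, hence so does the measure of S. *)
Lemma completed_setD_null (A B : set (@lebesgueR R)) : measurable A -> measurable B ->
  (forall a b : R, mu (A `&` `]a, b]) = mu (B `&` `]a, b])) ->
  mu.-negligible (A `\` B).
Proof.
move=> mA mB AB.
pose S n : set (@lebesgueR R) := (A `\` B) `&` `](- n%:R)%R, n%:R].
have mJ (a b : R) : measurable (`]a, b]%classic : set (@lebesgueR R)).
  by apply: sub_caratheodory; exact: measurable_itv.
have mS n : measurable (S n) by apply: measurableI => //; exact: measurableD.
have -> : A `\` B = \bigcup_n S n.
  apply/seteqP; split=> [x ABx|x [n _ []]//].
  exists (Num.truncn `|x|%R).+1 => //; split=> //=; rewrite in_itv/=.
  have := truncnS_gt `|x|%R; rewrite ltr_norml => /andP[-> /ltW ->].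
  by [].
apply: negligible_bigcup => n; apply/negligibleP => //.
apply/eqP; rewrite eq_le measure_ge0 andbT; apply/lee_addgt0Pr => e e0.
rewrite add0e.
have Sfin : mu (S n) \is a fin_num.
  rewrite ge0_fin_numE; last exact: measure_ge0.
  apply: (@le_lt_trans _ _ (mu `](- n%:R)%R, n%:R])).
    by apply: le_measure; rewrite ?inE//; exact: subIsetr.
  rewrite [mu _](lebesgue_measure_itv `](- n%:R)%R, n%:R])/=.
  by case: ifP => _; rewrite ?ltry// -EFinB ltry.
have [_ [J [mJc SJ] <-] Jlt] := lb_ereal_inf_adherent e0 Sfin.
rewrite -[ereal_inf _]/(mu (S n)) in Jlt.
have JE k : exists a b : R, J k = `]a, b]%classic.
  by have [[a b] _ <-] := mJc k; exists a, b.
have mJk k : measurable (J k : set (@lebesgueR R)).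
  by have [a [b ->]] := JE k.
have wJ k : wlength idfun (J k) = mu (J k `&` S n) + mu (J k `\` S n).
  rewrite -[LHS](@measurable_mu_extE _ _ _ (wlength idfun))//.
  rewrite -[LHS]/(mu (J k)) addeC -measureDI//.
pose x := \sum_(0 <= k <oo) mu (J k `&` S n).
pose y := \sum_(0 <= k <oo) mu (J k `\` S n).
have xy : \sum_(0 <= k <oo) wlength idfun (J k) = x + y.
  rewrite /x /y -nneseriesD//.
  by apply: eq_eseriesr => k _; exact: wJ.
have Sx : mu (S n) <= x.
  apply: measure_sigma_subadditive => //.
    by move=> k; exact: measurableI.
  by move=> t St; have [k _ Jt] := SJ t St; exists k.
have x_le_y : x <= y.
  apply: lee_nneseries => [k _ _|k _]; first exact: measure_ge0.
  have [a [b Jab]] := JE k.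
  apply: (@le_trans _ _ (mu (A `&` J k))).
    apply: le_measure; rewrite ?inE; [exact: measurableI|exact: measurableI|].
    by move=> t [Jt [[At _] _]].
  rewrite Jab AB -Jab; apply: le_measure; rewrite ?inE.
  - exact: measurableI.
  - exact: measurableD.
  - by move=> t [Bt Jt]; split=> // -[[_]].
have y0 : 0 <= y by apply: nneseries_ge0 => k _ _; exact: measure_ge0.
have xfin : x \is a fin_num.
  rewrite ge0_fin_numE; last by apply: nneseries_ge0 => k _ _; exact: measure_ge0.
  apply: (@le_lt_trans _ _ (x + y)); first by rewrite leeDl.
  rewrite -xy; apply: (lt_trans Jlt).
  by rewrite lte_add_pinfty ?ltry// -ge0_fin_numE// measure_ge0.
rewrite (le_trans Sx)// (le_trans x_le_y)//.
rewrite -(leeD2lE y e%:E xfin) -xy (le_trans (ltW Jlt))//.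
by rewrite leeD2r.
Qed.

Let cell_measure gamma (f : L0 gamma) (q a b : R) : \bar R :=
  lebesgueI gamma ([set t | (q < f t)%R] `&` `]a, b]).

Let code gamma (f : L0 gamma) : set (rat * rat * rat * rat)%type :=
  [set x | (ratr x.2)%:E <
    cell_measure f (ratr x.1.1.1) (ratr x.1.1.2) (ratr x.1.2)].

Let mcell gamma (f : L0 gamma) q a b :
  measurable ([set t | (q < f t)%R] `&` `]a, b] : set (@lebesgueR R)).
Proof.
apply: measurableI; last by apply: sub_caratheodory; exact: measurable_itv.
rewrite (_ : [set t | _] = f @^-1` `]q, +oo[%classic).
  by rewrite -[X in measurable X]setTI; apply: (@L0_measurable _ _ f) => //; exact: measurable_itv.
by apply/seteqP; split=> t /=; rewrite in_itv/= andbT.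
Qed.

Let cell_fin gamma (f : L0 gamma) q a b : cell_measure f q a b \is a fin_num.
Proof.
rewrite ge0_fin_numE; last exact: measure_ge0.
apply: (@le_lt_trans _ _ (mu `]a, b])).
  apply: le_measure; rewrite ?inE.
  - by apply: measurableI; [exact: mcell|exact: measurable_itvI].
  - by apply: sub_caratheodory; exact: measurable_itv.
  - by move=> t [[]].
rewrite [mu _](lebesgue_measure_itv `]a, b])/=.
by case: ifP => _; rewrite ?ltry// -EFinB ltry.
Qed.

Let code_rat gamma (f g : L0 gamma) (q a b : rat) : code f = code g ->
  cell_measure f (ratr q) (ratr a) (ratr b) <= cell_measure g (ratr q) (ratr a) (ratr b).
Proof.
move=> fg; rewrite leNgt; apply/negP.
have Fg := cell_fin g (ratr q) (ratr a) (ratr b).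
have Ff := cell_fin f (ratr q) (ratr a) (ratr b).
rewrite -(fineK Fg) -(fineK Ff) lte_fin => /rat_in_itvoo[r].
rewrite in_itv/= => /andP[gr rf].
have : code f (q, a, b, r).
  by rewrite /code/= -(fineK Ff) lte_fin; exact: rf.
by rewrite fg /code/= -(fineK Fg) lte_fin ltNge (ltW gr).
Qed.

(** Rational endpoints approximate real ones from outside, with an error of at
    most the added length. *)
Let code_le gamma (f g : L0 gamma) (q : rat) (a b : R) : code f = code g ->
  cell_measure f (ratr q) a b <= cell_measure g (ratr q) a b.
Proof.
move=> fg; apply/lee_addgt0Pr => e e0.
have aE : (a - e / 2 < a)%R by rewrite ltrBlDr ltrDl divr_gt0.
have bE : (b < b + e / 2)%R by rewrite ltrDl divr_gt0.
have [a'] := rat_in_itvoo aE; rewrite in_itv/= => /andP[aa' a'a].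
have [b'] := rat_in_itvoo bE; rewrite in_itv/= => /andP[bb' b'b].
have mI (c d : R) : measurable (`]c, d]%classic : set (@lebesgueR R)).
  by apply: sub_caratheodory; exact: measurable_itv.
have small (c d : R) : (c < d)%R -> (d - c <= e / 2)%R ->
    lebesgueI gamma `]c, d] <= (e / 2)%:E.
  move=> cd dce; apply: (@le_trans _ _ (mu `]c, d])).
    apply: le_measure; rewrite ?inE; last by move=> t [].
      by apply: measurableI; [exact: mI|exact: measurable_itvI].
    exact: mI.
  rewrite [mu _](lebesgue_measure_itv `]c, d])/= lte_fin cd -EFinB lee_fin.
  exact: dce.
apply: (@le_trans _ _ (cell_measure f (ratr q) (ratr a') (ratr b'))).
  apply: le_measure; rewrite ?inE; [exact: mcell..|].
  move=> t [qt /=]; rewrite in_itv/= => /andP[at_ tb]; split=> //=.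
  by rewrite in_itv/= (lt_trans a'a)//= (le_trans tb)// ltW.
apply: (le_trans (code_rat q a' b' fg)).
rewrite [e]splitr EFinD.
apply: (@le_trans _ _ (cell_measure g (ratr q) a b +
    (lebesgueI gamma `](ratr a'), a] + lebesgueI gamma `]b, (ratr b')]))).
  apply: (@le_trans _ _ (cell_measure g (ratr q) a b +
      lebesgueI gamma (`](ratr a'), a] `|` `]b, (ratr b')]))); last first.
    by rewrite leeD2l//; apply: measureU2.
  apply: (@le_trans _ _ (lebesgueI gamma
     (([set t | (ratr q < g t)%R] `&` `]a, b]) `|` (`](ratr a'), a] `|` `]b, (ratr b')])))).
    apply: le_measure; rewrite ?inE; first exact: mcell.
      by apply: measurableU; [exact: mcell|exact: measurableU].
    move=> t [qt /=]; rewrite in_itv/= => /andP[at_ tb].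
    have [ta|ta] := leP t a; first by right; left; rewrite /= in_itv/= at_.
    have [tb'|tb'] := leP t b; first by left; split=> //=; rewrite in_itv/= ta.
    by right; right; rewrite /= in_itv/= tb'.
  by apply: measureU2; [exact: mcell|exact: measurableU].
rewrite leeD2l// leeD//; apply: small => //.
  by move: aa'; rewrite ltrBlDr -ltrBlDl => /ltW.
by rewrite lerBlDl ltW.
Qed.

Let rat_enum : exists e : nat -> rat, forall q, exists n, e n = q.
Proof.
exists (fun n => odflt 0%R (unpickle n)) => q.
by exists (pickle q); rewrite pickleK.
Qed.

Let code_ae gamma (f g : L0 gamma) : code f = code g ->
  {ae lebesgueI gamma, forall t, (f t <= g t)%R}.
Proof.
move=> fg; have [e eP] := rat_enum.
have mA (h : L0 gamma) (q : R) : measurable ([set t | (q < h t)%R] : set (@lebesgueR R)).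
  rewrite (_ : [set t | _] = h @^-1` `]q, +oo[%classic).
    by rewrite -[X in measurable X]setTI; apply: (@L0_measurable _ _ h) => //; exact: measurable_itv.
  by apply/seteqP; split=> t /=; rewrite in_itv/= andbT.
have mI := @measurable_itvI R gamma.
have H : {ae lebesgueI gamma, forall t, forall n, ratr (e n) < f t -> ratr (e n) < g t}%R.
  apply/ae_foralln => n.
  have N : mu.-negligible (([set t | (ratr (e n) < f t)%R] `&` itvI gamma) `\`
     ([set t | (ratr (e n) < g t)%R] `&` itvI gamma)).
    apply: completed_setD_null; [exact: measurableI|exact: measurableI|].
    move=> a b; rewrite !(setIAC _ (itvI gamma)).
    by apply/eqP; rewrite eq_le (code_le _ _ _ fg) (code_le _ _ _ (esym fg)).
  have D0 : lebesgueI gamma ([set t | (ratr (e n) < f t)%R] `\` [set t | (ratr (e n) < g t)%R]) = 0.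
    rewrite -(measure_negligible _ N); last first.
      by apply: measurableD; exact: measurableI.
    congr (mu _); apply/seteqP; split=> t [].
      by move=> [ft gt_] It; split=> // -[].
    by move=> [ft It] nI; split=> //; split=> // gt_; apply: nI.
  have : (lebesgueI gamma).-negligible ([set t | (ratr (e n) < f t)%R] `\` [set t | (ratr (e n) < g t)%R]).
    by apply/negligibleP => //; exact: measurableD.
  by apply: negligibleS => t /= /not_implyP.
move: H; apply: lebesgueI_aeS => t H; rewrite leNgt; apply/negP.
move=> /rat_in_itvoo[q]; rewrite in_itv/= => /andP[gq qf].
by have [n en] := eP q; move: (H n); rewrite en => /(_ qf); rewrite ltNge (ltW gq).
Qed.

Lemma L0_card_le (gamma : \bar R) : ([set: L0 gamma] #<= [set: R])%card.
Proof.
apply: card_le_trans (@powerset_nat_card_le R).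
apply: card_le_trans (powerset_countable_card_le (rat * rat * rat * rat)%type).
apply: (@injective_card_le _ _ (@code gamma)) => // f g _ _ fg.
apply: L0_eq; apply: lebesgueI_aeS2 (code_ae fg) (code_ae (esym fg)) => t h1 h2.
by apply/eqP; rewrite eq_le h1 h2.
Qed.

End card_L0.

(** * The subspace of block functions *)

(** The factor 5^m makes the index as large as desired without changing the two
    valuations. *)
Lemma exists_logn23 (j n m : nat) :
  exists i, [/\ (m <= i)%N, logn 2 i = j & logn 3 i = n].
Proof.
exists (2 ^ j * (3 ^ n * 5 ^ m))%N; split.
- rewrite (leq_trans (ltnW (ltn_expl m (isT : (1 < 5)%N))))// mulnA.
  by rewrite leq_pmull// muln_gt0 !expn_gt0.
- by rewrite !lognM ?muln_gt0 ?expn_gt0// !lognX !logn_prime//= ?muln1 ?muln0 ?addn0.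
- by rewrite !lognM ?muln_gt0 ?expn_gt0// !lognX !logn_prime//= ?muln1 ?muln0 ?addn0.
Qed.

Lemma continuum_hamel (R : realType) (V : lmodType R) (S X : set V) :
  S `<=` X -> lin_indep S -> ([set: R] #<= S)%card ->
  ([set: V] #<= [set: R])%card ->
  exists2 B, hamel_basis B X & (B #= [set: R])%card.
Proof.
move=> SX Sind RS VR; have [B SB BX] := hamel_extension SX Sind.
exists B => //; rewrite card_eq_le; apply/andP; split.
  exact: card_le_trans (card_leT B) VR.
exact: card_le_trans RS (subset_card_le SB).
Qed.

Section sigmoid.
Context {R : realType}.

Let sigmoid (x : R) : R := (1 + expR x)^-1.

Let sigmoid_inj : injective sigmoid.
Proof. by move=> x y /invr_inj/addrI/expR_inj. Qed.

Let sigmoid_ge0 x : 0 <= sigmoid x.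
Proof. by rewrite invr_ge0 addr_ge0// expR_ge0. Qed.

Let sigmoid_le1 x : sigmoid x <= 1.
Proof. by rewrite invf_le1 ?lerDl ?expR_ge0// ltr_pwDl// expR_ge0. Qed.

(** Halves of the geometric sequences whose ratio runs over an injective image
    of the line in ]0, 1[. *)
Lemma independent_sequences : exists a : R -> nat -> R,
  (forall x k, `|a x k| <= 2^-1) /\
  (forall (s : seq R) (c : R -> R), uniq s ->
    (forall k, \sum_(x <- s) c x * a x k = 0) -> forall x, x \in s -> c x = 0).
Proof.
exists (fun x k => 2^-1 * sigmoid x ^+ k); split=> [x k|s c us H x xs].
  rewrite normrM normrX !ger0_norm ?invr_ge0// ler_piMr ?invr_ge0//.
  by rewrite exprn_ile1.
have [g gP] : exists g, cancel sigmoid g.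
  suff /choice[g gP] : forall y, exists x, forall z, sigmoid z = y -> z = x.
    by exists g => z; apply/esym/gP.
  move=> y; have [[z <-]|nz] := pselect (exists z, sigmoid z = y).
    by exists z => z' /sigmoid_inj.
  by exists 0 => z zy; exfalso; apply: nz; exists z.
have := @vandermonde _ (map sigmoid s) (c \o g).
rewrite map_inj_uniq// => /(_ us) vdm.
rewrite -[RHS](vdm _ (sigmoid x) (map_f _ xs)) /= ?gP// => k.
rewrite big_map; under eq_bigr do rewrite /= gP.
have /eqP : 2^-1 * (\sum_(y <- s) c y * sigmoid y ^+ k) = 0.
  by rewrite mulr_sumr -[RHS](H k); apply: eq_bigr => y _; rewrite mulrCA.
by rewrite mulf_eq0 invr_eq0 pnatr_eq0 => /eqP.
Qed.

End sigmoid.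

Section prec.
Context {R : realType} (gamma : \bar R) (w : R -> R).
Hypothesis gamma_gt0 : (0 < gamma)%E.
Hypothesis ww : weight_function gamma w.

(** For finite gamma the values of phi below the threshold are bounded by phi(u0),
    which is absorbed in the additive constant. *)
Lemma orlicz_lorentz_prec phi psi : orlicz_function phi -> orlicz_function psi ->
  (gamma = +oo%E -> orlicz_prec phi psi) ->
  ((gamma < +oo)%E -> orlicz_prec_infty phi psi) ->
  orlicz_lorentz gamma psi w `<=` orlicz_lorentz gamma phi w.
Proof.
move=> phiO psiO precy prec.
have [b [u0 [b0 u00 ub u0y]]] : exists b u0 : R, [/\ 0 < b, 0 <= u0,
    (forall u, u0 <= u -> phi u <= psi (b * u)) & (gamma = +oo%E -> u0 = 0)].
  have [gy|gy] := eqVneq gamma +oo%E.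
    by have [b b0 H] := precy gy; exists b, 0; split.
  have [b [u0 [b0 u00 H]]] : orlicz_prec_infty phi psi by apply: prec; rewrite ltey.
  by exists b, u0; split=> // gE; rewrite gE eqxx in gy.
pose C := Num.max 1 b.
have C1 : 1 <= C by rewrite le_max lexx.
have C0 : 0 < C by exact: lt_le_trans C1.
have Ci0 : 0 <= C^-1 by rewrite invr_ge0 ltW.
have bC : b <= C by rewrite le_max lexx orbT.
apply: (orlicz_lorentz_sub gamma_gt0 ww psiO phiO C0 (orlicz_ge0 phiO u00)).
  by move=> /u0y ->; case: phiO.
move=> u uge0; have psiu : 0 <= psi u by rewrite orlicz_ge0.
have [u0u|uu0] := leP u0 (C^-1 * u).
  apply: (@le_trans _ _ (psi u)); last first.
    by rewrite (@le_trans _ _ (C * psi u)) ?ler_peMl// lerDl orlicz_ge0.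
  apply: (le_trans (ub _ u0u)); apply: orlicz_le => //.
    by rewrite !mulr_ge0// ltW.
  by rewrite mulrA ler_piMl// ler_pdivrMr// mul1r.
rewrite (le_trans (orlicz_le phiO _ (ltW uu0)))//; first by rewrite mulr_ge0.
by rewrite lerDr mulr_ge0// ltW.
Qed.

End prec.

Theorem theorem4p13 (R : realType) (gamma : \bar R) (w : R -> R)
    (phi : R -> R) (phi_ : nat -> R -> R)
    (gamma_gt0 : (0 < gamma)%E)
    (w_weight : weight_function gamma w)
    (phi_orlicz : orlicz_function phi)
    (phi_n_orlicz : forall n, orlicz_function (phi_ n))
    (Delta2_case : gamma = +oo%E ->
       Delta2 phi /\ forall n, Delta2 (phi_ n))
    (Delta2_infty_case : (gamma < +oo)%E ->
       Delta2_infty phi /\ forall n, Delta2_infty (phi_ n))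
    (prec_case : gamma = +oo%E -> forall n, orlicz_prec phi (phi_ n))
    (prec_infty_case : (gamma < +oo)%E ->
       forall n, orlicz_prec_infty phi (phi_ n))
    (strict_incl : forall n,
       orlicz_lorentz gamma (phi_ n) w `<` orlicz_lorentz gamma (phi_ n.+1) w) :
  let X := orlicz_lorentz gamma phi w in
  let opens := norm_open X (luxemburg phi w) in
  let A := X `\` \bigcup_n orlicz_lorentz gamma (phi_ n) w in
  maximal_spaceable X opens A /\ spaceable X opens A [set: R].
Proof.
move=> X opens A.
have nsub n : ~ (X `<=` orlicz_lorentz gamma (phi_ n) w).
  move=> XL; have [_] := strict_incl n; apply; apply: subset_trans XL.
  by apply: orlicz_lorentz_prec => // [gy|gy]; [exact: prec_case|exact: prec_infty_case].
(* block i is built against phi_n for n the 3-adic valuation of i *)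
have [u /choice[b ub]] := choice (fun i => exists_step gamma_gt0 w_weight i
  phi_orlicz (phi_n_orlicz (logn 3 i)) (nsub (logn 3 i))).
have u0 i : 0 < u i by case: (ub i).
have b0 i : 0 < b i by case: (ub i).
have bg i : ((2 ^+ i.+1 * b i)%:E <= gamma)%E by case: (ub i).
have [F [mF tF muF]] := exists_cells gamma_gt0 b0 bg.
(* the 2-adic valuation of i selects the coefficient used on block i *)
pose T (a : nat -> R) : L0 gamma :=
  step_class gamma mF tF (fun i => a (logn 2 i) * u i).
have T_linear (x : R) (a a' : nat -> R) : T (fun k => x * a k + a' k) = x *: T a + T a'.
  rewrite -step_class_linear; congr step_class.
  by apply: funext => i; rewrite mulrDl mulrA.
have T_notin n (a : nat -> R) k : a k != 0 -> ~ orlicz_lorentz gamma (phi_ n) w (T a).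
  move=> ak; apply: (step_notin (mF := mF) (tF := tF) muF w_weight (k := logn 2) (phi_n_orlicz n) u0 ak _) => m.
  have [i [mi i2 i3]] := exists_logn23 k n m.
  by exists i; split=> //; case: (ub i); rewrite i3.
have T0 : T (fun=> 0) = 0.
  have := T_linear (-1) (fun=> 0) (fun=> 0); rewrite scaleN1r addNr.
  by under [X in T X]funext do rewrite mulr0 addr0.
have T_eq0 (a : nat -> R) k : T a = 0 -> a k = 0.
  move=> Ta0; apply/eqP; apply: contrapT => /negP/(T_notin 0); apply.
  by rewrite Ta0; exact: orlicz_lorentz0.
pose M : set (L0 gamma) := [set f | X f /\ exists a, f = T a].
have MX : M `<=` X by move=> f [].
have Msub : submod_closed (mem M).
  split.
    apply/mem_set; split; first exact: orlicz_lorentz0.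
    by exists (fun=> 0).
  move=> x f g /set_mem[Xf [a fE]] /set_mem[Xg [a' gE]].
  apply/mem_set; split; first exact: (orlicz_lorentz_linear w_weight x phi_orlicz Xf Xg).
  by exists (fun k => x * a k + a' k); rewrite T_linear fE gE.
have MA : M `<=` A `|` [set 0].
  move=> f [Xf [a fE]]; rewrite fE in Xf *.
  have [a0|/existsNP[k /eqP ak]] := pselect (forall k, a k = 0).
    by right; rewrite /= -T0; congr T; apply: funext.
  by left; split=> // -[n _]; exact: T_notin ak.
(* a function outside the range of T stays at a positive distance from it in
   measure, hence in norm *)
have Mopen : opens (X `\` M).
  split=> [f []//|f [Xf nMf]].
  have [e e0 He] : exists2 e : R, 0 < e & forall a, (e%:E < distr_fun (T a - f)%R e)%E.
    apply: contrapT => /forall2NP H; apply: nMf; split=> //.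
    apply: (@step_closed R gamma F b mF tF b0 muF (logn 2) u f) => // [n|e e0].
      by have [i [_ i2 _]] := exists_logn23 n 0 0; exists i.
    have [/(_ e0)//|/existsNP[a /negP]] := H e.
    by rewrite -leNgt => Ha; exists a.
  have [d d0 dP] := luxemburg_small gamma_gt0 w_weight phi_orlicz e0.
  exists d => // g Xg /dP ge; split=> // -[_ [a ga]].
  by move: ge; rewrite ga leNgt He.
have [a [a_le a_ind]] := @independent_sequences R.
pose f x := T (a x).
have fX x : X (f x).
  exists 1 => //; rewrite scale1r.
  apply: (@le_lt_trans _ _ 1%E); last by rewrite ltry.
  apply: le_trans (@modular_step_le R gamma F b mF tF muF w w_weight phi u _ phi_orlicz u0 _) _.
    move=> i; rewrite normrM (gtr0_norm (u0 i)) mulrC.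
    by rewrite ler_wpM2l// ltW.
  apply: le_trans (epsilon_trick0 xpredT ler01).
  apply: lee_nneseries => i _; last first.
    by case: (ub i) => _ _ _ + _; rewrite div1r natrX.
  by move=> _; rewrite mule_ge0 ?weight_int_ge0// lee_fin orlicz_ge0// ltW.
have sum_f (s : seq R) (c : R -> R) :
    \sum_(x <- s) c x *: f x = T (fun k => \sum_(x <- s) c x * a x k).
  elim: s => [|x s ih].
    by rewrite big_nil -T0; congr T; apply: funext => k; rewrite big_nil.
  rewrite big_cons ih -T_linear; congr T; apply: funext => k.
  by rewrite big_cons.
have f_ind (s : seq R) (c : R -> R) : uniq s -> \sum_(x <- s) c x *: f x = 0 ->
    forall x, x \in s -> c x = 0.
  by move=> us; rewrite sum_f => Tc; apply: a_ind => // k; exact: T_eq0 Tc.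
have f_inj : injective f.
  move=> x y fxy; apply: contrapT => /eqP xy.
  have := @f_ind [:: x; y] (fun z => if z == x then 1 else -1).
  rewrite /= inE xy big_cons big_seq1 eqxx eq_sym (negbTE xy) fxy scaleN1r scale1r subrr.
  by move=> /(_ isT erefl x (mem_head _ _))/eqP; rewrite eqxx oner_eq0.
(* M and X contain the same independent family and sit in the same L0 *)
have dim (Y : set (L0 gamma)) : M `<=` Y ->
    exists2 B, hamel_basis B Y & (B #= [set: R])%card.
  move=> MY; apply: (@continuum_hamel _ _ (range f)).
  - by move=> _ [x _ <-]; apply: MY; split; [exact: fX|exists (a x)].
  - exact: lin_indep_range.
  - by apply: (@injective_card_le _ _ f) => [x y _ _ /f_inj//|x _]; exists x.
  - exact: L0_card_le.
have [BM BM_basis BMR] := dim M (@subset_refl _ _).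
have [BX BX_basis BXR] := dim X MX.
split; last by exists M; split=> //; exists BM.
exists BX => //; exists M; split=> //; exists BM => //.
by rewrite (card_eq_trans BMR)// card_eq_sym.
Qed.
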